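(* C-Des-Add and C-Des-Del (under the Plurality rule) with a symmetric bundling function and disjoint bundles can be solved in $O(m\cdot|I|)$ time, where $|I|$ is the input size and $m$ is the number of candidates.
   Context: An election $(C,V)$: finite candidate set $C$, finite voter set $V$, each voter with one favorite candidate; $s_c(X)$ is the number of voters in $X$ with favorite $c$; $c$ is a (Plurality) winner if $s_c(V)\ge s_{c'}(V)$ for all $c'$. A bundling function on a voter set $X$ is $\kappa:X\to2^X$ with $x\in\kappa(x)$; $\kappa(X')=\bigcup_{x\in X'}\kappa(x)$; symmetric means for distinct $x,y$: $y\in\kappa(x)$ iff $x\in\kappa(y)$; disjoint means for distinct $x,y$ either $\kappa(x)=\kappa(y)$ or $\kappa(x)\cap\kappa(y)=\emptyset$. C-Des-Add: given an election $(C,V)$, unregistered voters $W$ with $V\cap W=\emptyset$, $\kappa:W\to2^W$, $p\in C$, $k\in\mathbb{N}$, decide whether some $W'\subseteq W$ with $|W'|\le k$ makes $p$ not a winner of $(C,V\cup\kappa(W'))$. C-Des-Del: given $(C,V)$, $\kappa:V\to2^V$, $p$, $k$, decide whether some $V'\subseteq V$ with $|V'|\le k$ makes $p$ not a winner of $(C,V\setminus\kappa(V'))$. *)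

(* Defs.v *)
From mathcomp Require Import all_boot.
Set Implicit Arguments. Unset Strict Implicit. Unset Printing Implicit Defensive.

(* Machine model: a unit-cost RAM with an unbounded memory of naturals  *)

Inductive instr : Type :=
| IConst of nat & nat
| IAdd of nat & nat & nat
| ISub of nat & nat & nat    (* ISub r a b   : mem[r] := mem[a] - mem[b] (truncated) *)
| ILoad of nat & nat
| IStore of nat & nat
| IJz of nat & nat
| IJmp of nat
| IHalt.

Definition program := seq instr.

Record rstate := RState { pc : nat; mem : nat -> nat }.

Definition upd (m : nat -> nat) (a v : nat) : nat -> nat :=
  fun x => if x == a then v else m x.

Definition halted (P : program) (s : rstate) : bool :=
  match nth IHalt P (pc s) with IHalt => true | _ => false end.

Definition step (P : program) (s : rstate) : rstate :=
  let m := mem s in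
  let n := (pc s).+1 in
  match nth IHalt P (pc s) with
  | IConst r c => RState n (upd m r c)
  | IAdd r a b => RState n (upd m r (m a + m b))
  | ISub r a b => RState n (upd m r (m a - m b))
  | ILoad r a => RState n (upd m r (m (m a)))
  | IStore a r => RState n (upd m (m a) (m r))
  | IJz r l => if m r == 0 then RState l m else RState n m
  | IJmp l => RState l m
  | IHalt => s
  end.

Definition init_state (input : seq nat) : rstate :=
  RState 0 (fun x => if x == 0 then size input
                     else if x <= size input then nth 0 input x.-1 else 0).

Definition run (P : program) (t : nat) (input : seq nat) : rstate :=
  iter t (step P) (init_state input).

Definition decides_within (P : program) (t : nat) (input : seq nat) (Q : Prop) : Prop :=
  halted P (run P t input) /\
  mem (run P t input) 0 <= 1 /\ (mem (run P t input) 0 = 1 <-> Q).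

(* Candidates are 0..m-1; voters are indices into a list of favourites. *)
(* A bundling function on voters 0..n-1 is a list of n lists, the i-th   *)
(* being kappa(i) (read as a set).                                      *)

Definition bundling_ok (n : nat) (kappa : seq (seq nat)) : Prop :=
  size kappa = n /\
  (forall i, i < n -> all (fun j => j < n) (nth [::] kappa i)) /\
  (forall i, i < n -> i \in nth [::] kappa i).

Definition bsymmetric (n : nat) (kappa : seq (seq nat)) : Prop :=
  forall i j, i < n -> j < n -> i != j ->
    (j \in nth [::] kappa i) = (i \in nth [::] kappa j).

Definition bdisjoint (n : nat) (kappa : seq (seq nat)) : Prop :=
  forall i j, i < n -> j < n -> i != j ->
    (nth [::] kappa i =i nth [::] kappa j) \/
    (forall x, x \in nth [::] kappa i -> x \notin nth [::] kappa j).

Definition in_bundle (kappa : seq (seq nat)) (X : seq nat) (w : nat) : bool :=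
  has (fun x => w \in nth [::] kappa x) X.

Definition score (fav : seq nat) (sel : pred nat) (c : nat) : nat :=
  count (fun w => sel w && (nth 0 fav w == c)) (iota 0 (size fav)).

Record AddInst := {
  am : nat;                   (* number of candidates *)
  afavV : seq nat;            (* favourites of registered voters V *)
  afavW : seq nat;            (* favourites of unregistered voters W *)
  akappa : seq (seq nat);     (* bundling function on W *)
  ap : nat;                   (* distinguished candidate *)
  ak : nat                    (* budget *)
}.

Definition add_wf (I : AddInst) : Prop :=
  ap I < am I /\ all (fun c => c < am I) (afavV I) /\
  all (fun c => c < am I) (afavW I) /\ bundling_ok (size (afavW I)) (akappa I).

(* score of c in (C, V u kappa(W')); V and W are disjoint voter sets *)
Definition add_score (I : AddInst) (W' : seq nat) (c : nat) : nat :=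
  score (afavV I) predT c + score (afavW I) (in_bundle (akappa I) W') c.

Definition CDesAdd (I : AddInst) : Prop :=
  exists W' : seq nat,
    uniq W' /\ all (fun w => w < size (afavW I)) W' /\ size W' <= ak I /\
    exists c, c < am I /\ add_score I W' (ap I) < add_score I W' c.

Definition enc_bundles (kappa : seq (seq nat)) : seq nat :=
  flatten [seq size s :: s | s <- kappa].

Definition enc_add (I : AddInst) : seq nat :=
  [:: am I; size (afavV I)] ++ afavV I ++ [:: size (afavW I)] ++ afavW I ++
  enc_bundles (akappa I) ++ [:: ap I; ak I].

Record DelInst := {
  dm : nat;
  dfavV : seq nat;
  dkappa : seq (seq nat);     (* bundling function on V *)
  dp : nat;
  dk : nat
}.

Definition del_wf (I : DelInst) : Prop :=
  dp I < dm I /\ all (fun c => c < dm I) (dfavV I) /\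
  bundling_ok (size (dfavV I)) (dkappa I).

Definition del_score (I : DelInst) (V' : seq nat) (c : nat) : nat :=
  score (dfavV I) (fun w => ~~ in_bundle (dkappa I) V' w) c.

Definition CDesDel (I : DelInst) : Prop :=
  exists V' : seq nat,
    uniq V' /\ all (fun v => v < size (dfavV I)) V' /\ size V' <= dk I /\
    exists c, c < dm I /\ del_score I V' (dp I) < del_score I V' c.

Definition enc_del (I : DelInst) : seq nat :=
  [:: dm I; size (dfavV I)] ++ dfavV I ++ enc_bundles (dkappa I) ++ [:: dp I; dk I].

(* Main.v *)
(** With disjoint bundles the voters split into classes, labelled by the least voter of
    their bundle, and a choice of at most [k] voters amounts to a choice of at most [k]
    classes. A fixed challenger overtakes the distinguished candidate [p] iff the sum of
    the [k] largest positive class gains exceeds the initial lead of [p]. That sum is the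
    sum over [g >= 1] of [min k (N g)], where [N g] is the number of classes of gain at
    least [g]; since gains are bounded by the number of voters, a histogram of the gains
    yields it in linear time, for each of the [m] challengers. *)

Require Import Defs.
From mathcomp Require Import all_boot.
From mathcomp Require Import zify.
Set Implicit Arguments. Unset Strict Implicit. Unset Printing Implicit Defensive.

(** * Selecting classes of bundles *)

(** The time bound is about a concrete machine, so an actual program has to be produced and its
    steps counted. It is written in a structured language whose loops are bounded on entry, with a
    cost counter in the state; [comp_cmdP] charges at most 60 machine steps per unit of cost, and
    from then on only structured programs are analysed. The input initially fills the low cells that
    compiled code wants for itself, hence the relocation that precedes everything else.

    The bundles together may have quadratically many entries in the number of voters. They are
    scanned once, outside the loop over challengers, which leaves one label per voter; each
    challenger then costs time linear in the number of voters. Least members serve as labels because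
    one scan of a bundle finds them without any search for the class.

    Gains are truncated differences throughout. A class of negative gain then counts as gain 0 and
    is invisible at every threshold, which matches the optimal choice leaving it out; labels that
    belong to no class are harmless for the same reason. *)

Definition cnt (n : nat) (P : pred nat) := count P (iota 0 n).

Lemma cntS n P : cnt n.+1 P = cnt n P + P n.
Proof. by rewrite /cnt -addn1 iotaD count_cat /= addn0. Qed.

Lemma cnt_le n P : cnt n P <= n.
Proof. by rewrite -{2}(size_iota 0 n) count_size. Qed.

Lemma eq_cnt n P Q : (forall i, i < n -> P i = Q i) -> cnt n P = cnt n Q.
Proof. by move=> h; apply: eq_in_count => i; rewrite mem_iota => /andP[_ hi]; exact: h. Qed.

Lemma layer_cake n (v : nat) : v <= n -> \sum_(g < n) (g < v) = v.
Proof.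
elim: n v => [|n IH] v; first by rewrite big_ord0; case: v.
rewrite big_ord_recr /= leq_eqVlt => /orP[/eqP->|hv].
  rewrite ltnSn (eq_bigr (fun=> 1)) => [|i _]; first by rewrite sum1_card card_ord addn1.
  by rewrite ltnS ltnW.
by rewrite IH // ltnNge -ltnS hv addn0.
Qed.

(** In decreasing order the items above a threshold form a prefix, whatever the threshold. Hence one
    choice, the first [k] items, is optimal for all thresholds simultaneously. *)
Lemma count_take_sorted (f : nat -> nat) g k s :
  sorted (fun u v => f v <= f u) s ->
  count (fun r => g < f r) (take k s) = minn k (count (fun r => g < f r) s).
Proof.
have tr : transitive (fun u v => f v <= f u) by move=> y x z h1 h2; exact: leq_trans h2 h1.
elim: s k => [|x s IH] [|k] //=; rewrite ?minn0 ?min0n //.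
move=> hp; have hs := path_sorted hp.
rewrite IH //; case: (ltnP g (f x)) => hg /=; first by lia.
suff -> : count (fun r => g < f r) s = 0 by lia.
apply/eqP; rewrite -leqn0 leqNgt -has_count; apply/hasPn => y ys.
have /allP/(_ y ys) /= := order_path_min tr hp.
by rewrite -leqNgt => h; exact: leq_trans h hg.
Qed.

Lemma sum_le_layers (s : seq nat) (f : nat -> nat) n :
  {in s, forall r, f r <= n} ->
  \sum_(r <- s) f r = \sum_(g < n) count (fun r => g < f r) s.
Proof.
move=> h; rewrite big_seq (eq_bigr (fun r => \sum_(g < n) (g < f r))); last first.
  by move=> r rs; rewrite layer_cake // h.
rewrite -big_seq exchange_big /=; apply: eq_bigr => g _.
by rewrite -sum1_count [RHS]big_mkcond; apply: eq_bigr => r _; case: ltnP.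
Qed.

Lemma count_uniq_le (s : seq nat) n P : uniq s -> all (fun r => r < n) s ->
  count P s <= cnt n P.
Proof.
move=> us hs; rewrite /cnt -!size_filter; apply: uniq_leq_size; first exact: filter_uniq.
move=> x; rewrite !mem_filter => /andP[-> xs] /=.
by rewrite mem_iota /= add0n (allP hs).
Qed.

(* Counting, for each threshold [g], the items of [R] whose gain exceeds [g]
   turns the value of the best choice of at most [k] items into a sum over thresholds. *)
Lemma best_choice n k x y (a b : nat -> nat) :
  (forall r, r < n -> a r <= n) ->
  (exists R, [/\ uniq R, all (fun r => r < n) R, size R <= k &
     x + \sum_(r <- R) b r < y + \sum_(r <- R) a r])
  <-> x < y + \sum_(g < n) minn k (cnt n (fun r => g < a r - b r)).
Proof.
move=> han; have gn r : r < n -> a r - b r <= n by move/han; lia.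
split=> [[R [uR aR sR hR]]|h].
  apply: leq_trans (_ : y + \sum_(r <- R) (a r - b r) <= _).
    have : \sum_(r <- R) a r <= \sum_(r <- R) b r + \sum_(r <- R) (a r - b r).
      by rewrite -big_split; apply: leq_sum => r _ /=; lia.
    by move: hR; lia.
  rewrite leq_add2l (@sum_le_layers _ _ n) => [|r /(allP aR)/gn //].
  apply: leq_sum => g _; rewrite leq_min count_uniq_le // andbT.
  exact: leq_trans (count_size _ _) sR.
pose le u v := a v - b v <= a u - b u.
have tot : total le by move=> u v; rewrite /le leq_total.
(* Dropping the items without positive gain makes truncated subtraction exact on [R], and changes no
   count, since [g < a r - b r] already forces [b r < a r]. *)
pose R := [seq r <- take k (sort le (iota 0 n)) | b r < a r].
have sub : {subset take k (sort le (iota 0 n)) <= iota 0 n}.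
  by move=> r /mem_take; rewrite mem_sort.
exists R; split.
- by rewrite filter_uniq // take_uniq // sort_uniq iota_uniq.
- by apply/allP=> r; rewrite mem_filter => /andP[_ /sub]; rewrite mem_iota.
- by rewrite size_filter (leq_trans (count_size _ _)) // size_take_min geq_minl.
have -> : \sum_(r <- R) a r = \sum_(r <- R) b r + \sum_(r <- R) (a r - b r).
  rewrite -big_split /= big_seq [RHS]big_seq; apply: eq_bigr => r.
  by rewrite mem_filter => /andP[h1 _]; lia.
suff -> : \sum_(r <- R) (a r - b r) = \sum_(g < n) minn k (cnt n (fun r => g < a r - b r)).
  by rewrite addnCA [x + _]addnC ltn_add2l.
rewrite (@sum_le_layers _ _ n) => [|r]; last first.
  by rewrite mem_filter => /andP[_ /sub]; rewrite mem_iota => /gn.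
apply: eq_bigr => g _; rewrite count_filter.
rewrite (@eq_count _ _ (fun r => g < a r - b r)) => [|r /=]; last by lia.
by rewrite (@count_take_sorted (fun r => a r - b r)) ?sort_sorted // /cnt count_sort.
Qed.

(** * Disjoint bundles as labelled classes of voters *)

Definition class_count (rep fav : nat -> nat) n v r :=
  cnt n (fun i => (rep i == r) && (fav i == v)).

Lemma sum_class_count rep fav n v R : uniq R ->
  \sum_(r <- R) class_count rep fav n v r = cnt n (fun i => (rep i \in R) && (fav i == v)).
Proof.
elim: R => [|r R IH] /=.
  by rewrite big_nil (eq_cnt (Q := pred0)) // /cnt count_pred0.
case/andP=> rR uR; rewrite big_cons IH // /class_count /cnt.
rewrite -count_predUI [X in _ + X](@eq_count _ _ pred0) ?count_pred0 ?addn0.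
  by apply: eq_count => i /=; rewrite inE -andb_orl.
move=> i /=; case: eqP => //= ->; by rewrite (negbTE rR) andbF.
Qed.

Section Classes.
Variables (n : nat) (kappa : seq (seq nat)).
Hypotheses (ok : bundling_ok n kappa) (dis : bdisjoint n kappa).

(** Folding from the first element over the whole list is exactly what the loop in [read_bundle]
    computes. *)
Definition bundle_rep i := foldl minn (head 0 (nth [::] kappa i)) (nth [::] kappa i).

Lemma foldl_minn_mem d s : foldl minn d s \in d :: s.
Proof.
elim: s d => [|x s IH] d /=; first exact: mem_head.
by have := IH (minn d x); rewrite !inE; case: leqP => _ /orP[/eqP->|->];
  rewrite ?eqxx ?orbT.
Qed.

Lemma foldl_minn_le d s x : x \in d :: s -> foldl minn d s <= x.
Proof.
elim: s d x => [|y s IH] d x /=; first by rewrite inE => /eqP->.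
rewrite !inE orbA => /orP[h|h]; last by apply: IH; rewrite inE h orbT.
apply: leq_trans (IH (minn d y) _ (mem_head _ _)) _.
by case/orP: h => /eqP->; rewrite geq_min leqnn ?orbT.
Qed.

Lemma bundle_rep_mem i : i < n -> bundle_rep i \in nth [::] kappa i.
Proof.
case: ok => _ [_ /[apply]]; rewrite /bundle_rep.
case: (nth _ _ _) => // x s _; have := foldl_minn_mem x (x :: s).
by rewrite !inE orbA orbb.
Qed.

Lemma bundle_rep_le i x : x \in nth [::] kappa i -> bundle_rep i <= x.
Proof. by move=> h; apply: foldl_minn_le; rewrite inE h orbT. Qed.

Lemma bundle_lt i x : i < n -> x \in nth [::] kappa i -> x < n.
Proof. by case: ok => _ [h _] /h /allP; apply. Qed.

Lemma bundle_rep_lt i : i < n -> bundle_rep i < n.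
Proof. by move=> hi; apply: bundle_lt hi (bundle_rep_mem hi). Qed.

Lemma bundle_meet i j x : i < n -> j < n ->
  x \in nth [::] kappa i -> x \in nth [::] kappa j -> nth [::] kappa i =i nth [::] kappa j.
Proof.
move=> hi hj xi xj; have [->//|ne] := eqVneq i j.
by case: (dis hi hj ne) => // /(_ _ xi); rewrite xj.
Qed.

(** A shared voter forces two bundles to be equal. If [i] is in the bundle of [j], the shared voter
    is [i] itself, and equal bundles have equal minima; conversely a common minimum is a shared
    voter. *)
Lemma bundle_repP i j : i < n -> j < n ->
  (i \in nth [::] kappa j) = (bundle_rep i == bundle_rep j).
Proof.
move=> hi hj; have ii : i \in nth [::] kappa i by case: ok => _ [_ ->].
apply/idP/eqP => [ij|e].
  have E := bundle_meet hi hj ii ij.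
  apply/eqP; rewrite eqn_leq !bundle_rep_le ?E ?bundle_rep_mem //.
  by rewrite -E bundle_rep_mem.
have ri := bundle_rep_mem hi; rewrite e in ri.
by rewrite -(bundle_meet hi hj ri (bundle_rep_mem hj)).
Qed.

Lemma in_bundleE X w : w < n -> all (fun x => x < n) X ->
  in_bundle kappa X w = (bundle_rep w \in undup (map bundle_rep X)).
Proof.
move=> hw hX; rewrite mem_undup; apply/hasP/mapP => [] [x xX h]; exists x => //.
  by apply/eqP; rewrite -bundle_repP // (allP hX).
by rewrite bundle_repP ?h ?eqxx // (allP hX).
Qed.

(* A selection of voters matters only through the set of classes it meets, and
   a class is nonempty only if its label represents itself. *)
Lemma select_classes k (fav : nat -> nat) (T : nat -> nat -> Prop) u v :
  (exists X, [/\ uniq X, all (fun x => x < n) X, size X <= k &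
     T (cnt n (fun w => in_bundle kappa X w && (fav w == u)))
       (cnt n (fun w => in_bundle kappa X w && (fav w == v)))])
  <-> (exists R, [/\ uniq R, all (fun x => x < n) R, size R <= k &
     T (\sum_(r <- R) class_count bundle_rep fav n u r)
       (\sum_(r <- R) class_count bundle_rep fav n v r)]).
Proof.
have score X z : all (fun x => x < n) X ->
    cnt n (fun w => in_bundle kappa X w && (fav w == z)) =
    \sum_(r <- undup (map bundle_rep X)) class_count bundle_rep fav n z r.
  move=> hX; rewrite sum_class_count ?undup_uniq //.
  by apply: eq_cnt => w hw; rewrite in_bundleE.
split=> [[X [uX aX sX TX]]|[R [uR aR sR TR]]].
  exists (undup (map bundle_rep X)); split; first exact: undup_uniq.
  - apply/allP=> r; rewrite mem_undup => /mapP[x /(allP aX) hx ->].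
    exact: bundle_rep_lt.
  - by rewrite (leq_trans (size_undup _)) // size_map.
  by rewrite -!score.
pose X := [seq r <- R | bundle_rep r == r].
have aX : all (fun x => x < n) X.
  by apply/allP=> r; rewrite mem_filter => /andP[_ /(allP aR)].
have mX : map bundle_rep X = X.
  by rewrite -[RHS]map_id; apply/eq_in_map => r; rewrite mem_filter => /andP[/eqP].
have uX : uniq X by rewrite filter_uniq.
exists X; split=> //.
  by rewrite size_filter (leq_trans (count_size _ _)).
suff E z : \sum_(r <- undup (map bundle_rep X)) class_count bundle_rep fav n z r =
    \sum_(r <- R) class_count bundle_rep fav n z r by rewrite !score // !E.
rewrite mX undup_id // /X big_filter [RHS](bigID (fun r => bundle_rep r == r)) /=.
rewrite [X in _ = _ + X]big1 ?addn0 // => r hr.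
rewrite /class_count (eq_cnt (Q := pred0)) ?/cnt ?count_pred0 // => i hi /=.
(* A voter [i] labelled [r] has [r] in its bundle, so [r] would represent itself. *)
apply/andP=> [[/eqP e _]]; case/negP: hr; rewrite -e; apply/eqP.
apply/eqP; rewrite -bundle_repP ?bundle_rep_lt //.
exact: bundle_rep_mem.
Qed.

End Classes.

(** * A structured language and its compilation *)

Arguments upd : simpl never.

Definition nregs := 20.
Definition heap0 := 32.

(* A language whose loop [CLoop r b] runs [b] as many times as the value of [r] on entry,
   so that execution is a total function; [tm] counts atomic commands and loop tests. *)
Inductive expr :=
| EC of nat
| ER of nat
| EAdd of expr & expr
| ESub of expr & expr
| ELd of expr.

Inductive cmd :=
| CSet of nat & expr
| CStore of expr & expr
| CSeq of cmd & cmd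
| CLoop of nat & cmd.

Record state := State { rg : nat -> nat; hp : nat -> nat; tm : nat }.

Fixpoint eval (s : state) (e : expr) : nat :=
  match e with
  | EC n => n
  | ER r => rg s r
  | EAdd e1 e2 => eval s e1 + eval s e2
  | ESub e1 e2 => eval s e1 - eval s e2
  | ELd e1 => hp s (eval s e1)
  end.

Definition dec r s := State (upd (rg s) r (rg s r).-1) (hp s) (tm s).+1.

Fixpoint exec (c : cmd) (s : state) : state :=
  match c with
  | CSet r e => State (upd (rg s) r (eval s e)) (hp s) (tm s).+1
  | CStore a e => State (rg s) (upd (hp s) (eval s a) (eval s e)) (tm s).+1
  | CSeq c1 c2 => exec c2 (exec c1 s)
  | CLoop r b =>
      let s' := iter (rg s r) (fun s => dec r (exec b s)) s in
      State (rg s') (hp s') (tm s').+1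
  end.

Fixpoint mods (c : cmd) : seq nat :=
  match c with
  | CSet r _ => [:: r]
  | CStore _ _ => [::]
  | CSeq c1 c2 => mods c1 ++ mods c2
  | CLoop r b => r :: mods b
  end.

Lemma updE m a v x : upd m a v x = if x == a then v else m x.
Proof. by []. Qed.

Lemma exec_frame c s x : x \notin mods c -> rg (exec c s) x = rg s x.
Proof.
elim: c s => [r e|a e|c1 IH1 c2 IH2|r b IH] s //=.
- by rewrite inE /upd => /negbTE->.
- by rewrite mem_cat negb_or => /andP[h1 h2]; rewrite IH2 // IH1.
rewrite inE negb_or => /andP[xr xb].
elim: (rg s r) => [//|n IHn] /=.
by rewrite updE (negbTE xr) IH.
Qed.

(** Invariant rule. Each step is given the value of the counter and the registers that the loop does
    not modify, so an invariant need only describe what the body changes. *)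
Lemma exec_loop r b (I : nat -> state -> Prop) s0 :
  r \notin mods b -> I 0 s0 ->
  (forall i s, i < rg s0 r -> rg s r = rg s0 r - i ->
     (forall x, x \notin r :: mods b -> rg s x = rg s0 x) ->
     I i s -> I i.+1 (dec r (exec b s))) ->
  exists s, [/\ I (rg s0 r) s, forall x, x \notin r :: mods b -> rg s x = rg s0 x
    & exec (CLoop r b) s0 = State (rg s) (hp s) (tm s).+1].
Proof.
move=> rb I0 IS; rewrite /=.
set n := rg s0 r in IS *.
pose f s := dec r (exec b s).
have H : forall k, k <= n -> [/\ I k (iter k f s0), rg (iter k f s0) r = n - k
   & forall x, x \notin r :: mods b -> rg (iter k f s0) x = rg s0 x].
  elim=> [|k IHk] lek; first by split; rewrite //= subn0.
  have [Ik rk fk] := IHk (ltnW lek).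
  split=> /=.
  - exact: IS.
  - by rewrite updE eqxx exec_frame // rk; lia.
  move=> x; rewrite inE negb_or => /andP[xr xb].
  by rewrite updE (negbTE xr) exec_frame // fk // inE negb_or xr.
have [In rn fn] := H n (leqnn n).
by exists (iter n f s0).
Qed.

(** * Translation into machine code *)

Definition ieff (i : instr) (m : nat -> nat) : nat -> nat :=
  match i with
  | IConst r c => upd m r c
  | IAdd r a b => upd m r (m a + m b)
  | ISub r a b => upd m r (m a - m b)
  | ILoad r a => upd m r (m (m a))
  | IStore a r => upd m (m a) (m r)
  | _ => m
  end.

Definition straight (i : instr) : bool :=
  match i with IJz _ _ | IJmp _ | IHalt => false | _ => true end.

Definition ieffs (s : seq instr) m := foldl (fun m i => ieff i m) m s.

Definition code_at (P : program) (off : nat) (c : seq instr) : Prop :=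
  forall i, i < size c -> nth IHalt P (off + i) = nth IHalt c i.

Lemma code_at_cat P off c1 c2 :
  code_at P off (c1 ++ c2) -> code_at P off c1 /\ code_at P (off + size c1) c2.
Proof.
move=> h; split=> i hi.
  by rewrite h ?size_cat ?nth_cat ?hi //; lia.
rewrite -addnA h ?size_cat ?ltn_add2l // nth_cat.
by rewrite ltnNge leq_addr /= addKn.
Qed.

Lemma code_at_cons P off i c :
  code_at P off (i :: c) -> nth IHalt P off = i /\ code_at P off.+1 c.
Proof.
move=> h; split; first by have := h 0 erefl; rewrite addn0.
by move=> j hj; rewrite addSnnS h.
Qed.

Lemma run_straight P c off m : all straight c -> code_at P off c ->
  iter (size c) (step P) (RState off m) = RState (off + size c) (ieffs c m).
Proof.
elim: c off m => [|i c IH] off m /=; first by rewrite addn0.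
case/andP=> hi hc /code_at_cons[hn hcode].
rewrite -iterS iterSr.
have -> : step P (RState off m) = RState off.+1 (ieff i m).
  by rewrite /step /= hn; case: i hi {hn}.
by rewrite IH // addSnnS.
Qed.

Fixpoint comp_expr (d : nat) (e : expr) : seq instr :=
  let t := nregs + d in
  match e with
  | EC n => [:: IConst t n]
  | ER r => [:: IConst t 0; IAdd t t r]
  | EAdd e1 e2 => comp_expr d e1 ++ comp_expr d.+1 e2 ++ [:: IAdd t t t.+1]
  | ESub e1 e2 => comp_expr d e1 ++ comp_expr d.+1 e2 ++ [:: ISub t t t.+1]
  | ELd e1 => comp_expr d e1 ++ [:: IConst t.+1 heap0; IAdd t t t.+1; ILoad t t]
  end.

Fixpoint wf_expr (d : nat) (e : expr) : bool :=
  match e with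
  | EC n => nregs + d < heap0
  | ER r => (r < nregs) && (nregs + d < heap0)
  | EAdd e1 e2 | ESub e1 e2 => wf_expr d e1 && wf_expr d.+1 e2
  | ELd e1 => wf_expr d e1 && (nregs + d.+1 < heap0)
  end.

Lemma wf_expr_lt d e : wf_expr d e -> nregs + d < heap0.
Proof.
by elim: e d => [n|r|e IH e2 _|e IH e2 _|e IH] d //= /andP[] // /IH.
Qed.

(* Cells [0 .. nregs - 1] hold the registers, cells [nregs .. heap0 - 1] are scratch space
   for expressions, and heap address [h] is cell [heap0 + h]. *)
Definition represents (m : nat -> nat) (s : state) : Prop :=
  (forall x, x < nregs -> m x = rg s x) /\ (forall h, m (heap0 + h) = hp s h).

Lemma represents_ext m m' s : represents m s ->
  (forall x, (x < nregs) || (heap0 <= x) -> m' x = m x) -> represents m' s.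
Proof.
case=> rm rh h; split=> [x hx|a]; first by rewrite h ?hx // rm.
by rewrite h ?leq_addr ?orbT // rh.
Qed.

Lemma ieffs_cat c1 c2 m : ieffs (c1 ++ c2) m = ieffs c2 (ieffs c1 m).
Proof. exact: foldl_cat. Qed.

Lemma straight_expr d e : all straight (comp_expr d e).
Proof.
by elim: e d => //= [e1 IH1 e2 IH2|e1 IH1 e2 IH2|e IH] d; rewrite !all_cat ?IH1 ?IH2 ?IH.
Qed.

(** Scratch cells behave as a stack. The frame clause carries the induction: an operand evaluated at
    depth [d.+1] preserves the registers, the heap and the first operand's value in cell
    [nregs + d]. *)
Lemma comp_exprP e d m s : represents m s -> wf_expr d e ->
  ieffs (comp_expr d e) m (nregs + d) = eval s e /\
  (forall x, (x < nregs + d) || (heap0 <= x) -> ieffs (comp_expr d e) m x = m x).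
Proof.
have bin e1 e2 : (forall d m, represents m s -> wf_expr d e1 ->
    ieffs (comp_expr d e1) m (nregs + d) = eval s e1 /\
    (forall x, (x < nregs + d) || (heap0 <= x) -> ieffs (comp_expr d e1) m x = m x)) ->
  (forall d m, represents m s -> wf_expr d e2 ->
    ieffs (comp_expr d e2) m (nregs + d) = eval s e2 /\
    (forall x, (x < nregs + d) || (heap0 <= x) -> ieffs (comp_expr d e2) m x = m x)) ->
  forall d m, represents m s -> wf_expr d e1 && wf_expr d.+1 e2 ->
   let m2 := ieffs (comp_expr d.+1 e2) (ieffs (comp_expr d e1) m) in
   [/\ m2 (nregs + d) = eval s e1, m2 (nregs + d).+1 = eval s e2 &
    forall x, (x < nregs + d) || (heap0 <= x) -> m2 x = m x].
  move=> IH1 IH2 {}d {}m rm /andP[w1 w2].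
  have [v1 f1] := IH1 d m rm w1.
  have rm1 : represents (ieffs (comp_expr d e1) m) s.
    by apply: represents_ext rm _ => x hx; apply: f1; lia.
  have [v2 f2] := IH2 d.+1 _ rm1 w2.
  split=> [||x hx].
  - by rewrite f2 ?v1 //; lia.
  - by rewrite -addnS v2.
  by rewrite f2 ?f1 //; lia.
elim: e d m => [n|r|e1 IH1 e2 IH2|e1 IH1 e2 IH2|e IH] d m rm /=.
- move=> hd; rewrite !updE eqxx; split=> // x hx; rewrite updE ifF //; lia.
- case/andP=> hr hd; rewrite !updE eqxx; split=> [|x hx].
    by rewrite ifF ?add0n; [case: rm => -> | lia].
  by rewrite !updE !ifF //; lia.
- move=> w; have [v1 v2 f] := bin _ _ IH1 IH2 d m rm w.
  rewrite !ieffs_cat /= updE eqxx v1 v2; split=> // x hx.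
  by rewrite updE ifF ?f //; case/andP: w => /wf_expr_lt; lia.
- move=> w; have [v1 v2 f] := bin _ _ IH1 IH2 d m rm w.
  rewrite !ieffs_cat /= updE eqxx v1 v2; split=> // x hx.
  by rewrite updE ifF ?f //; case/andP: w => /wf_expr_lt; lia.
case/andP=> w hd; have [v f] := IH d m rm w.
rewrite !ieffs_cat /= !updE !eqxx /= v.
have ne : nregs + d == (nregs + d).+1 = false by lia.
rewrite ne; split=> [|x hx].
  rewrite ifF; last by lia.
  rewrite ifF; last by lia.
  rewrite f; last by lia.
  by rewrite addnC; case: rm => _ ->.
by rewrite !updE !ifF ?f //; lia.
Qed.

(** Jumps are absolute, hence the offset. The exit target of a loop skips the test, the body and the
    three closing instructions. *)
Fixpoint comp_cmd (off : nat) (c : cmd) : seq instr :=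
  match c with
  | CSet r e => comp_expr 0 e ++ [:: IConst nregs.+1 0; IAdd r nregs nregs.+1]
  | CStore a e => comp_expr 0 a ++ comp_expr 1 e ++
      [:: IConst nregs.+2 heap0; IAdd nregs nregs nregs.+2; IStore nregs nregs.+1]
  | CSeq c1 c2 => let p1 := comp_cmd off c1 in p1 ++ comp_cmd (off + size p1) c2
  | CLoop r b => let p := comp_cmd off.+1 b in
      IJz r (off + size p + 4) :: p ++ [:: IConst nregs 1; ISub r r nregs; IJmp off]
  end.

(** The bound 60 converts cost into machine steps; code of an atomic command does not depend on its
    offset, so measuring it at 0 suffices. For the two final programs all of this is checked by
    computation. *)
Fixpoint wf_cmd (c : cmd) : bool :=
  match c with
  | CSet r e => [&& r < nregs, wf_expr 0 e & size (comp_cmd 0 c) <= 60]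
  | CStore a e => [&& wf_expr 0 a, wf_expr 1 e & size (comp_cmd 0 c) <= 60]
  | CSeq c1 c2 => wf_cmd c1 && wf_cmd c2
  | CLoop r b => [&& r < nregs, r \notin mods b & wf_cmd b]
  end.

Lemma comp_cmdP P c off m s : wf_cmd c -> code_at P off (comp_cmd off c) ->
  represents m s ->
  exists t m', [/\ represents m' (exec c s), tm s <= tm (exec c s),
     t <= 60 * (tm (exec c s) - tm s) &
     iter t (step P) (RState off m) = RState (off + size (comp_cmd off c)) m'].
Proof.
elim: c off m s => [r e|a e|c1 IH1 c2 IH2|r b IH] off m s.
- move=> /and3P[hr we sz] hc rm.
  have [v f] := comp_exprP rm we.
  exists (size (comp_cmd off (CSet r e))), (ieffs (comp_cmd off (CSet r e)) m); split.
  + rewrite ieffs_cat /=; move: v f; rewrite addn0; set m1 := ieffs _ _ => v f.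
    have m1E x : x < nregs \/ heap0 <= x -> m1 x = m x by move=> hx; apply: f; lia.
    have hh : nregs == nregs.+1 = false by [].
    case: rm => rm rh; split=> [x hx|h]; rewrite /= !updE.
      rewrite !eqxx hh v addn0; case: eqP => // _.
      by rewrite ifF ?m1E ?rm //; [left | lia].
    by rewrite !ifF ?m1E ?rh //; rewrite /nregs /heap0 in hr *; lia.
  + by rewrite /=; lia.
  + by move: sz; rewrite /=; lia.
  + by apply: run_straight => //; rewrite /= all_cat straight_expr.
- move=> /and3P[wa we sz] hc rm.
  have [va fa] := comp_exprP rm wa.
  have rm1 : represents (ieffs (comp_expr 0 a) m) s.
    by apply: represents_ext rm _ => x hx; apply: fa; lia.
  have [ve fe] := comp_exprP rm1 we.
  exists (size (comp_cmd off (CStore a e))), (ieffs (comp_cmd off (CStore a e)) m); split.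
  + rewrite !ieffs_cat /=; move: va fa ve fe; rewrite addn0 addn1.
    set m1 := ieffs _ m; set m2 := ieffs _ m1 => va fa ve fe.
    have m2n : m2 nregs = eval s a by rewrite fe ?va // ltnSn.
    have m2E x : x < nregs \/ heap0 <= x -> m2 x = m x.
      by move=> hx; rewrite fe ?fa //; rewrite /nregs /heap0 in hx *; lia.
    have hh : (nregs == nregs.+2 = false) * (nregs.+1 == nregs.+2 = false) *
      (nregs.+1 == nregs = false) by [].
    case: rm => rm rh; split=> [x hx|h]; rewrite /= !updE !eqxx !hh m2n ve [eval s a + _]addnC.
      rewrite ifF; last by rewrite /nregs /heap0 in hx *; lia.
      rewrite ifF; last by lia.
      rewrite ifF; last by lia.
      by rewrite m2E ?rm //; left.
    rewrite eqn_add2l; case: eqP => // _.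
    have -> : heap0 + h == nregs = false by [].
    have -> : heap0 + h == nregs.+2 = false by [].
    by rewrite m2E ?rh //; right; lia.
  + by rewrite /=; lia.
  + by move: sz; rewrite /=; lia.
  + by apply: run_straight => //; rewrite /= !all_cat !straight_expr.
- move=> /andP[w1 w2] /code_at_cat[h1 h2] rm.
  have [t1 [m1 [r1 l1 b1 i1]]] := IH1 _ _ _ w1 h1 rm.
  have [t2 [m2 [r2 l2 b2 i2]]] := IH2 _ _ _ w2 h2 r1.
  exists (t2 + t1), m2; split=> //=; try lia.
  by rewrite iterD i1 i2 size_cat addnA.
move=> /and3P[hr rb wb] hcode rm.
have [hjz /code_at_cat[hb]] := code_at_cons hcode.
set n := size (comp_cmd off.+1 b) in hjz hb *.
move/code_at_cons=> [hk /code_at_cons[hs /code_at_cons[hj _]]].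
have -> : off + size (comp_cmd off (CLoop r b)) = off + n + 4.
  by rewrite /= size_cat -/n /=; lia.
set f := fun s => dec r (exec b s).
(* The extra [1] is the failing test that leaves the loop; the last tick of [CLoop] pays for it. The
   tick in [dec] pays for the four instructions around each run of the body. *)
have key : forall k m s, rg s r = k -> represents m s ->
  exists t m', [/\ represents m' (iter k f s), tm s <= tm (iter k f s),
     t <= 60 * (tm (iter k f s) - tm s) + 1 &
     iter t (step P) (RState off m) = RState (off + n + 4) m'].
  elim=> [|k IHk] {rm}m {}s rk rm.
    exists 1, m; split=> //=; first by rewrite addn1.
    by rewrite /step /= hjz; case: (rm) => -> // _; rewrite rk eqxx.
  have [t1 [m1 [r1 l1 b1 i1]]] := IH _ _ _ wb hb rm.
  pose m2 := ieffs [:: IConst nregs 1; ISub r r nregs] m1.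
  have r2 : represents m2 (f s).
    case: r1 => r1 h1; split=> [x hx|h] /=; rewrite /m2 /= !updE eqxx.
      have -> : r == nregs = false by lia.
      rewrite r1 // subn1; case: eqP => // _.
      have -> : x == nregs = false by lia.
      by rewrite r1.
    have -> : heap0 + h == r = false by rewrite /nregs /heap0 in hr *; lia.
    have -> : heap0 + h == nregs = false by [].
    by rewrite h1.
  have rk2 : rg (f s) r = k by rewrite /f /dec /= updE eqxx exec_frame // rk.
  have [t3 [m3 [r3 l3 b3 i3]]] := IHk _ _ rk2 r2.
  exists (t3 + (3 + (t1 + 1))), m3; rewrite iterSr.
  have tmf : tm (f s) = (tm (exec b s)).+1 by [].
  split=> //; try lia.
  rewrite iterD [iter (3 + _) _ _]iterD [iter (t1 + 1) _ _]iterD.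
  have -> : iter 1 (step P) (RState off m) = RState off.+1 m.
    by rewrite /= /step /= hjz; case: (rm) => -> // _; rewrite rk.
  rewrite i1 -/n.
  have -> : iter 3 (step P) (RState (off.+1 + n) m1) = RState off m2.
    by rewrite /= /step /= hk /= hs /= hj.
  exact: i3.
have [t [m' [r1 l1 b1 i1]]] := key _ m s erefl rm.
exists t, m'; split=> //=; rewrite -/f; lia.
Qed.

(* [rP], [rQ]: read and write pointers; [rI], [rS], [rJ]: loop counters; [rV], [rW], [rR]:
   addresses of the favourites of the fixed voters, of those of the bundled voters, and of
   the bundle representatives; [rNV], [rNW]: numbers of voters; [rPP], [rK]: distinguished
   candidate and budget; [rC]: current challenger; [rF]: start of the untouched memory. *)
Notation rANS := 0 (only parsing).
Notation rP := 1 (only parsing).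
Notation rI := 2 (only parsing).
Notation rNV := 3 (only parsing).
Notation rV := 4 (only parsing).
Notation rNW := 5 (only parsing).
Notation rW := 6 (only parsing).
Notation rR := 7 (only parsing).
Notation rQ := 8 (only parsing).
Notation rS := 9 (only parsing).
Notation rMN := 10 (only parsing).
Notation rPP := 11 (only parsing).
Notation rK := 12 (only parsing).
Notation rF := 13 (only parsing).
Notation rC := 14 (only parsing).
Notation rJ := 15 (only parsing).
Notation rX := 16 (only parsing).
Notation rY := 17 (only parsing).
Notation rU := 18 (only parsing).
Notation rN := 19 (only parsing).

(** * Relocating the input *)

Definition save (i : nat) : seq instr := [:: IAdd 0 0 1; IStore 0 i].

(* The input occupies the cells meant for registers. Cell 0 holds its length [N]; doubling
   it five times gives an address beyond both the input and the register area, where the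
   cells [1 .. heap0 - 1] are saved one by one. *)
Definition prologue : seq instr :=
  nseq 5 (IAdd 0 0 0) ++ [:: IStore 0 1; IConst 1 1] ++ flatten (map save (iota 2 30)).

Definition move_cell : cmd :=
  CStore (EAdd (EAdd (ER rP) (ESub (ER rP) (ER rI))) (EC 31))
         (ELd (ESub (ER rP) (ER rI))).

(* The prologue leaves [rANS = 32 * size input + 30] and input symbol number [j], for
   [j < 31], at heap address [rP + j]; the loop moves the symbols still in place from
   heap address [j - 31] to [rP + j]. *)
Definition move_input : cmd :=
  CSeq (CSet rP (ESub (ER 0) (EC 62)))
  (CSeq (CSet rI (ER rP))
  (CLoop rI move_cell)).

Definition compile (c : cmd) : program :=
  prologue ++ comp_cmd (size prologue) (CSeq move_input c).

(** Cell 0 is the write pointer and cell 1 its increment, the old content of cell 1 having been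
    stored at [Q] beforehand. The sources are cells 2 to 31, all below [Q], so no save destroys a
    later source. *)
Lemma save_loop (Q k : nat) (m : nat -> nat) :
  heap0 <= Q -> m 0 = Q -> m 1 = 1 ->
  let m' := ieffs (flatten (map save (iota 2 k))) m in
  k <= 30 ->
  [/\ m' 0 = Q + k, m' 1 = 1 &
      forall x, 1 < x -> m' x = if (Q < x <= Q + k) then m (x - Q).+1 else m x].
Proof.
have h32 : heap0 = 32 by [].
move=> hQ m0 m1; elim: k => [|k IH].
  by move=> m' _; split; rewrite /m' /= ?addn0 // => x _; case: ifP => //; lia.
move=> m' hk; have [i0 i1 ix] := IH (ltnW hk).
have -> : m' = ieffs (save (2 + k)) (ieffs (flatten (map save (iota 2 k))) m).
  by rewrite /m' -[k.+1]addn1 iotaD map_cat flatten_cat ieffs_cat.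
move: i0 i1 ix; set mk := ieffs (flatten _) m => i0 i1 ix; rewrite /ieffs /save /=.
rewrite !updE /= i0 i1; split=> [||x hx].
- by rewrite ifF ?addnA //; lia.
- by rewrite ifF //; lia.
have hx0 : (x == 0) = false by lia.
rewrite !updE hx0 !ix //.
have [->|ne] := eqVneq x (Q + k + 1).
  rewrite ifF; last by lia.
  by rewrite ifT; [congr (m _); lia | lia].
case: ifP => h; case: ifP => h' //; lia.
Qed.

Lemma straight_prologue : all straight prologue.
Proof. by []. Qed.

Lemma prologueP input : 0 < size input ->
  let Q := 32 * size input in
  let m := Defs.mem (init_state input) in
  let m' := ieffs prologue m in
  m' 0 = Q + 30 /\
  forall x, heap0 <= x -> m' x = if Q <= x <= Q + 30 then nth 0 input (x - Q)
     else nth 0 input x.-1.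
Proof.
move=> hN Q m m'; rewrite /m' /prologue ieffs_cat ieffs_cat.
set m1 := ieffs (nseq _ _) m.
have hm1 : m1 0 = Q /\ forall x, 0 < x -> m1 x = m x.
  by split=> [|[|x] // _]; rewrite /m1 /= !updE //= /m /Q /=; lia.
set m2 := ieffs _ m1.
have hQ : heap0 <= Q by rewrite /Q /heap0; lia.
have minit x : 0 < x -> m x = nth 0 input x.-1.
  case: x => // x _; rewrite /m /=; case: ltnP => // h; by rewrite nth_default.
case: hm1 => m10 m1x.
have m2E x : x != 1 -> m2 x = if x == Q then nth 0 input 0 else m1 x.
  by move=> hx; rewrite /m2 /= !updE (negbTE hx) m10 m1x // minit.
have m20 : m2 0 = Q by rewrite m2E // ifF //; rewrite /heap0 in hQ; lia.
have m21 : m2 1 = 1 by [].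
have [h0 h1 hx] := save_loop hQ m20 m21 (leqnn 30).
split=> // x hhx; rewrite hx; last by rewrite /heap0 in hhx; lia.
rewrite /heap0 in hQ hhx.
case: ifP => h.
  rewrite m2E; last by lia.
  rewrite ifF; last by lia.
  rewrite m1x // minit // ifT //; lia.
rewrite m2E; last by lia.
case: eqP => e; first by rewrite ifT ?e ?subnn //; lia.
rewrite m1x ?minit; try lia.
by rewrite ifF //; lia.
Qed.

Lemma move_inputP input s : 0 < size input ->
  let Q := 32 * size input in
  rg s 0 = Q + 30 ->
  (forall h, hp s h = if Q <= heap0 + h <= Q + 30 then nth 0 input (heap0 + h - Q)
     else nth 0 input (heap0 + h).-1) ->
  let s' := exec move_input s in
  (forall j, hp s' (rg s' rP + j) = nth 0 input j) /\ tm s' <= tm s + 64 * size input + 3.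
Proof.
move=> hN Q r0 hh.
(* [B] is the heap address of cell [Q], and the 62 subtracted by the program is 30 plus [heap0]. The
   [B] iterations reach the end of the input since [B] is at least [size input - 31]; they read
   below [B] and write from [B + 31] on, so nothing is overwritten before it is read. *)
pose B := Q - 32.
pose s1 := State (upd (upd (rg s) rP B) rI B) (hp s) (tm s).+2.
have -> : exec move_input s = exec (CLoop rI move_cell) s1.
  rewrite /move_input /= updE /= r0.
  by have -> : Q + 30 - 62 = B by rewrite /B; lia.
case: (@exec_loop rI move_cell
  (fun i s2 => tm s2 = tm s1 + 2 * i /\ forall h, hp s2 h =
     if B + 31 <= h < B + 31 + i then hp s (h - (B + 31)) else hp s h) s1) => //.
- by split=> [|h]; [rewrite muln0 addn0 | rewrite ifF //; lia].
- move=> i s2; rewrite [rg s1 rI]/= updE /= => hi r2 f2 [t2 h2].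
  split; first by rewrite /= t2; lia.
  have p2 : rg s2 rP = B by rewrite f2.
  have iB : B - (B - i) = i by lia.
  move=> h; rewrite /= p2 r2 iB updE.
  have -> : hp s2 i = hp s i by rewrite h2 ifF //; lia.
  have [->|ne] := eqVneq h (B + i + 31).
    by rewrite ifT; [congr (hp s _); lia | lia].
  rewrite h2; case: ifP => e1; case: ifP => e2 //; lia.
move=> s2 [[t2 h2] f2 ->]; have p2 : rg s2 rP = B by rewrite f2.
have n2 : rg s1 rI = B by [].
rewrite n2 in t2 h2.
split; last by rewrite /= t2 /B /Q /=; lia.
move=> j; rewrite /= p2 h2; case: ifP => h; rewrite hh.
  rewrite ifF; last by rewrite /heap0; move: h; rewrite /B; lia.
  by congr nth; rewrite /heap0; move: h; rewrite /B; lia.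
case: ifP => h'; rewrite /heap0 /B in h h' *.
  by congr nth; lia.
rewrite !nth_default //; lia.
Qed.

Lemma halted_stable P s t : halted P s -> iter t (step P) s = s.
Proof.
move=> h; elim: t => //= t ->; rewrite /step; move: h; rewrite /halted.
by case: (nth _ _ _).
Qed.

(** Interface between the machine and structured programs. Because of the default of [nth], the
    assumption on the heap also says that everything after the input is zero, which supplies the
    fresh memory. *)
Lemma compile_decides c input (Q : Prop) T : wf_cmd c -> 0 < size input ->
  (forall s, tm s <= 64 * size input + 3 ->
     (forall j, hp s (rg s rP + j) = nth 0 input j) ->
     [/\ rg (exec c s) rANS <= 1, rg (exec c s) rANS = 1 <-> Q &
       size prologue + 60 * tm (exec c s) <= T]) ->
  decides_within (compile c) T input Q.
Proof.
move=> wc hN H.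
have [m Em] : exists m, m = ieffs prologue (Defs.mem (init_state input)) by eexists.
have [m0 mh] := prologueP hN; rewrite -!Em in m0 mh.
pose s := State m (fun h => m (heap0 + h)) 0.
have [hs ts] : (forall j, hp (exec move_input s) (rg (exec move_input s) rP + j) = nth 0 input j)
    /\ tm (exec move_input s) <= tm s + 64 * size input + 3.
  apply: (move_inputP hN); first exact: m0.
  by move=> h; apply: mh; rewrite leq_addr.
have [b1 b2 b3] := H _ ts hs.
have /code_at_cat[c1 c2] : code_at (compile c) 0 (compile c) by move=> i _; rewrite add0n.
have e1 : iter (size prologue) (step (compile c)) (init_state input) =
    RState (0 + size prologue) m.
  by rewrite Em; exact: (run_straight _ straight_prologue c1).
have w : wf_cmd (CSeq move_input c) by apply/andP; split.
have rm : represents m s by split.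
have [t [m' [[r' _] l b e2]]] := comp_cmdP w c2 rm.
have tT : t + size prologue <= T.
  apply: leq_trans b3; rewrite addnC leq_add2l; apply: (leq_trans b).
  by rewrite leq_mul2l; apply/orP; right; exact: leq_subr.
(* Execution runs off the end of the code, where [nth] yields [IHalt]; the machine then idles until
   step [T]. *)
have E : run (compile c) T input = RState (size (compile c)) m'.
  rewrite /run -(subnK tT) iterD iterD e1 e2 halted_stable.
    by rewrite /compile size_cat.
  by rewrite /halted nth_default // /compile size_cat.
rewrite /decides_within E; split; first by rewrite /halted nth_default.
have r0 : m' rANS = rg (exec c (exec move_input s)) rANS := r' 0 isT.
change (m' rANS <= 1 /\ (m' rANS = 1 <-> Q)); rewrite r0; split; [exact: b1 | exact: b2].
Qed.

(** * The program *)

(** Counting down a copy keeps the bound in [r], so that [r - rI] is an ascending index, as in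
    [item]. *)
Definition cfor (r : nat) (b : cmd) : cmd := CSeq (CSet rI (ER r)) (CLoop rI b).

Lemma exec_seq c1 c2 s : exec (CSeq c1 c2) s = exec c2 (exec c1 s).
Proof. by []. Qed.

Lemma exec_for r b (I : nat -> state -> Prop) s0 :
  rI \notin mods b -> r \notin rI :: mods b ->
  I 0 (State (upd (rg s0) rI (rg s0 r)) (hp s0) (tm s0).+1) ->
  (forall i s, i < rg s0 r -> rg s rI = rg s0 r - i ->
     (forall x, x \notin rI :: mods b -> rg s x = rg s0 x) ->
     I i s -> I i.+1 (dec rI (exec b s))) ->
  exists s, [/\ I (rg s0 r) s, forall x, x \notin rI :: mods b -> rg s x = rg s0 x
    & exec (cfor r b) s0 = State (rg s) (hp s) (tm s).+1].
Proof.
move=> rb rr I0 IS; rewrite /cfor exec_seq.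
set s1 := State _ _ _ in I0 *.
have n1 : rg s1 rI = rg s0 r by [].
have f1 x : x \notin rI :: mods b -> rg s1 x = rg s0 x.
  by rewrite inE negb_or => /andP[/negbTE h _]; rewrite /= updE h.
case: (@exec_loop rI b I s1 rb I0) => [i s|s [h1 h2 h3]].
  by rewrite n1 => h1 h2 h3; apply: IS => // x hx; rewrite h3 // f1.
rewrite n1 in h1; exists s; split=> // x hx; rewrite h2 // f1 //.
Qed.

Definition eEq a b := ESub (EC 1) (EAdd (ESub a b) (ESub b a)).

Lemma eval_eEq s a b : eval s (eEq a b) = (eval s a == eval s b).
Proof. by rewrite /=; case: eqP; lia. Qed.

Definition item rbase rn := ELd (EAdd (ER rbase) (ESub (ER rn) (ER rI))).
Definition incr r e := CSet r (EAdd (ER r) e).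
Definition add_at r e := CStore (ER r) (EAdd (ELd (ER r)) e).

Lemma hp_add_at r e s h :
  hp (exec (add_at r e) s) h = upd (hp s) (rg s r) (hp s (rg s r) + eval s e) h.
Proof. by []. Qed.

Lemma rg_incr r e s : rg (exec (incr r e) s) r = rg s r + eval s e.
Proof. by rewrite /= updE eqxx. Qed.

Definition score_voter : cmd :=
  CSeq (incr rX (eEq (item rV rNV) (ER rPP)))
       (incr rY (eEq (item rV rNV) (ER rC))).

Definition base_scores : cmd :=
  CSeq (CSet rX (EC 0)) (CSeq (CSet rY (EC 0))
  (cfor rNV score_voter)).

Lemma eval_item s rb rn i : i < rg s rn -> rg s rI = rg s rn - i ->
  eval s (item rb rn) = hp s (rg s rb + i).
Proof. by move=> hi h; rewrite /= h; congr (hp s _); lia. Qed.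

(* Keeps simplification from unfolding these inside [exec] and [eval]. *)
Opaque eEq item cfor.

Lemma base_scoresP s :
  let s' := exec base_scores s in
  [/\ rg s' rX = cnt (rg s rNV) (fun i => hp s (rg s rV + i) == rg s rPP),
      rg s' rY = cnt (rg s rNV) (fun i => hp s (rg s rV + i) == rg s rC),
      hp s' =1 hp s & tm s' = tm s + 3 * rg s rNV + 4].
Proof.
rewrite /base_scores 2!exec_seq; set s1 := exec (CSet _ _) (exec _ _).
have nv : rg s1 rNV = rg s rNV by [].
case: (@exec_for rNV score_voter
  (fun i s2 => [/\ rg s2 rX = cnt i (fun i => hp s (rg s rV + i) == rg s rPP),
      rg s2 rY = cnt i (fun i => hp s (rg s rV + i) == rg s rC),
      hp s2 =1 hp s & tm s2 = tm s + 3 * i + 3]) s1) => //.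
- by split=> //=; lia.
- move=> i s2; rewrite nv => hi r2 f2 [x2 y2 h2 t2].
  have [fN fV fP fC] : [/\ rg s2 rNV = rg s rNV, rg s2 rV = rg s rV,
    rg s2 rPP = rg s rPP & rg s2 rC = rg s rC] by split; rewrite f2.
  split; rewrite /= ?updE //=.
  + by rewrite x2 cntS !eval_eEq (eval_item _ (i := i)) ?fN //= h2 fV fP.
  + rewrite y2 cntS !eval_eEq (eval_item _ (i := i)) /= ?updE /= ?fN //.
    by rewrite h2 fV fC.
  + by rewrite t2; lia.
move=> s2 [[x2 y2 h2 t2] _ ->]; split=> //=; rewrite ?x2 ?y2 ?t2 ?nv //; lia.
Qed.

(* For class [r], cell [rF + r] counts the voters with favourite [rA] and cell
   [rF + rNW + r] those with favourite [rB]. *)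
Definition tally_voter (rA rB : nat) : cmd :=
  CSeq (CSet rU (EAdd (ER rF) (item rR rNW)))
  (CSeq (add_at rU (eEq (item rW rNW) (ER rA)))
  (CSeq (incr rU (ER rNW))
        (add_at rU (eEq (item rW rNW) (ER rB))))).

Definition tally_classes (rA rB : nat) : cmd :=
  cfor rNW (tally_voter rA rB).

Lemma class_countS rep fav n v r :
  class_count rep fav n.+1 v r = class_count rep fav n v r + ((rep n == r) && (fav n == v)).
Proof. exact: cntS. Qed.

Lemma tally_classesP rA rB s n F rep fav :
  rA \notin [:: rI; rU] -> rB \notin [:: rI; rU] ->
  rg s rNW = n -> rg s rF = F -> rg s rR + n <= F -> rg s rW + n <= F ->
  (forall i, i < n -> hp s (rg s rR + i) = rep i) ->
  (forall i, i < n -> hp s (rg s rW + i) = fav i) ->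
  (forall i, i < n -> rep i < n) ->
  (forall h, F <= h -> hp s h = 0) ->
  let s' := exec (tally_classes rA rB) s in
  [/\ forall r, r < n -> hp s' (F + r) = class_count rep fav n (rg s rA) r,
      forall r, r < n -> hp s' (F + n + r) = class_count rep fav n (rg s rB) r,
      forall h, h < F -> hp s' h = hp s h,
      forall h, F + n + n <= h -> hp s' h = 0
    & tm s' = tm s + 5 * n + 2].
Proof.
move=> hA hB sn sF hR hW hrep hfav ltrep hz.
rewrite !inE !negb_or in hA hB.
case: (@exec_for rNW (tally_voter rA rB)
  (fun i s2 => [/\ forall r, r < n -> hp s2 (F + r) = class_count rep fav i (rg s rA) r,
      forall r, r < n -> hp s2 (F + n + r) = class_count rep fav i (rg s rB) r,
      forall h, h < F -> hp s2 h = hp s h,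
      forall h, F + n + n <= h -> hp s2 h = 0
    & tm s2 = tm s + 5 * i + 1]) s) => //.
- by split=> //= [r hr|r hr|h hh|]; rewrite ?hz //; lia.
- move=> i s2; rewrite sn => hi r2 f2 [a2 b2 h2 z2 t2].
  have [fN fF fR fW] : [/\ rg s2 rNW = n, rg s2 rF = F,
    rg s2 rR = rg s rR & rg s2 rW = rg s rW] by split; rewrite f2.
  have fA : rg s2 rA = rg s rA by rewrite f2 // !inE !negb_or; case/andP: hA => -> ->.
  have fB : rg s2 rB = rg s rB by rewrite f2 // !inE !negb_or; case/andP: hB => -> ->.
  have [_ uA] := andP hA; have [_ uB] := andP hB.
  have li := ltrep _ hi.
  rewrite 3!exec_seq; set s3 := exec (CSet _ _) s2.
  have u3 : rg s3 rU = F + rep i.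
    rewrite /s3 /= updE /= (eval_item _ (i := i)) ?fN // fR fF h2 ?hrep //; lia.
  have f3 x : x != rU -> rg s3 x = rg s2 x by move=> hx; rewrite exec_frame // inE.
  set s4 := exec _ s3.
  have e4 h : hp s4 h = upd (hp s2) (F + rep i) (hp s2 (F + rep i) + (fav i == rg s rA)) h.
    rewrite /s4 hp_add_at u3 eval_eEq (eval_item _ (i := i)) ?f3 ?fN //.
    have -> : eval s3 (ER rA) = rg s rA by rewrite -fA; exact: f3.
    have -> : hp s3 (rg s2 rW + i) = fav i by rewrite -hfav // -fW; apply: h2; lia.
    by [].
  have u4 x : rg s4 x = rg s3 x by [].
  set s5 := exec _ s4.
  have u5 : rg s5 rU = F + rep i + n.
    by rewrite /s5 rg_incr u4 u3; congr (_ + _); rewrite -fN; exact: f3.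
  have f5 x : x != rU -> rg s5 x = rg s2 x.
    by move=> hx; rewrite exec_frame ?inE // u4 f3.
  set s6 := exec _ s5.
  have e6 h : hp s6 h = upd (hp s4) (F + rep i + n)
       (hp s4 (F + rep i + n) + (fav i == rg s rB)) h.
    rewrite /s6 hp_add_at u5 eval_eEq (eval_item _ (i := i)) ?f5 ?fN //.
    have -> : eval s5 (ER rB) = rg s rB by rewrite -fB; exact: f5.
    have -> : hp s5 (rg s2 rW + i) = fav i.
      by rewrite [LHS]e4 updE ifF ?h2 fW ?hfav //; lia.
    by [].
  split.
  + move=> r hr; rewrite [LHS]e6 updE ifF ?e4 ?updE; last by lia.
    rewrite eqn_add2l class_countS [rep i == r]eq_sym.
    by case: eqP => [->|_]; rewrite a2 ?addn0.
  + move=> r hr; rewrite [LHS]e6 updE class_countS.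
    have -> : (F + n + r == F + rep i + n) = (rep i == r) by apply/eqP/eqP; lia.
    case: eqP => [e|_]; rewrite e4 updE ifF; try lia.
      by rewrite -addnA [_ + n]addnC addnA b2 ?e.
    by rewrite b2 // addn0.
  + by move=> h hh; rewrite [LHS]e6 updE ifF ?e4 ?updE ?ifF ?h2 //; lia.
  + by move=> h hh; rewrite [LHS]e6 updE ifF ?e4 ?updE ?ifF ?z2 //; lia.
  by rewrite /= t2; lia.
move=> s2 [[a2 b2 h2 z2 t2] _ e]; rewrite sn in a2 b2 t2.
by rewrite /tally_classes e; split=> //=; rewrite t2; lia.
Qed.

(* Cell [rF + 2 rNW + g] counts the classes of (truncated) gain [g]. *)
Definition count_gain : cmd :=
  CSeq (CSet rU (EAdd (ER rF) (ESub (ER rNW) (ER rI))))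
  (CSeq (CSet rU (EAdd (EAdd (ER rF) (EAdd (ER rNW) (ER rNW)))
                       (ESub (ELd (ER rU)) (ELd (EAdd (ER rU) (ER rNW))))))
        (add_at rU (EC 1))).

Definition histogram : cmd :=
  cfor rNW count_gain.

(** Truncated gains lie between 0 and [n], so the histogram takes [n + 1] cells; with the two
    tallies this makes the [3 n + 1] cells by which [conclude] advances [rF]. Cell 0 of the
    histogram collects the useless classes and is never read by [add_layer]. *)
Lemma histogramP s n F a b :
  rg s rNW = n -> rg s rF = F ->
  (forall r, r < n -> hp s (F + r) = a r) ->
  (forall r, r < n -> hp s (F + n + r) = b r) ->
  (forall r, r < n -> a r <= n) ->
  (forall h, F + n + n <= h -> hp s h = 0) ->
  let s' := exec histogram s in
  [/\ forall g, g <= n -> hp s' (F + n + n + g) = cnt n (fun r => a r - b r == g),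
      forall h, h < F + n + n -> hp s' h = hp s h,
      forall h, F + n + n + n < h -> hp s' h = 0
    & tm s' = tm s + 4 * n + 2].
Proof.
move=> sn sF ha hb lea hz.
case: (@exec_for rNW count_gain
  (fun i s2 => [/\ forall g, g <= n -> hp s2 (F + n + n + g) = cnt i (fun r => a r - b r == g),
      forall h, h < F + n + n -> hp s2 h = hp s h,
      forall h, F + n + n + n < h -> hp s2 h = 0
    & tm s2 = tm s + 4 * i + 1]) s) => //.
- by split=> //= [r hr|r hr|]; rewrite ?hz //; lia.
- move=> i s2; rewrite sn => hi r2 f2 [a2 h2 z2 t2].
  have [fN fF] : rg s2 rNW = n /\ rg s2 rF = F by split; rewrite f2.
  have ii : n - (n - i) = i by lia.
  have li := lea _ hi.
  set s3 := exec _ s2.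
  have e3 h : hp s3 h = upd (hp s2) (F + n + n + (a i - b i))
     (hp s2 (F + n + n + (a i - b i)) + 1) h.
    rewrite /s3 /= ![upd (upd _ _ _) _ _ _]updE ![upd (rg s2) _ _ _]updE /=.
    rewrite fN fF r2 ii.
    have -> : hp s2 (F + i) = a i by rewrite h2 ?ha //; lia.
    have -> : hp s2 (F + i + n) = b i.
      by rewrite h2 -?hb //; [congr (hp s _) |]; lia.
    by rewrite addnA.
  split.
  + move=> g hg; rewrite [LHS]e3 updE eqn_add2l cntS [_ == g]eq_sym.
    by case: eqP => [->|_]; rewrite a2 ?addn0 //; lia.
  + by move=> h hh; rewrite [LHS]e3 updE ifF ?h2 //; lia.
  + by move=> h hh; rewrite [LHS]e3 updE ifF ?z2 //; lia.
  by rewrite /= t2; lia.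
move=> s2 [[a2 h2 z2 t2] _ e]; rewrite sn in a2 t2.
by rewrite /histogram e; split=> //=; rewrite t2; lia.
Qed.

(* The loop counter [rI] runs through the gains downwards, so [rN] is the number of classes
   of gain at least [rI]. *)
Definition add_layer : cmd :=
  CSeq (incr rN (ELd (EAdd (EAdd (ER rF) (EAdd (ER rNW) (ER rNW))) (ER rI))))
       (incr rY (ESub (ER rK) (ESub (ER rK) (ER rN)))).

Definition add_best : cmd :=
  CSeq (CSet rN (EC 0))
  (cfor rNW add_layer).

Lemma add_bestP s n F gain :
  rg s rNW = n -> rg s rF = F -> (forall r, r < n -> gain r <= n) ->
  (forall g, g <= n -> hp s (F + n + n + g) = cnt n (fun r => gain r == g)) ->
  let s' := exec add_best s in
  [/\ rg s' rY = rg s rY + \sum_(g < n) minn (rg s rK) (cnt n (fun r => g < gain r)),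
      hp s' =1 hp s & tm s' = tm s + 3 * n + 3].
Proof.
move=> sn sF legain hg.
rewrite /add_best exec_seq; set s1 := exec (CSet _ _) s.
have n1 : rg s1 rNW = n by [].
case: (@exec_for rNW add_layer
  (fun i s2 => [/\ rg s2 rN = cnt n (fun r => n - i < gain r),
      rg s2 rY = rg s rY + \sum_(j < i) minn (rg s rK) (cnt n (fun r => n - j.+1 < gain r)),
      hp s2 =1 hp s & tm s2 = tm s + 3 * i + 2]) s1) => //.
- split=> //=; last by lia.
    rewrite updE /= subn0 (eq_cnt (Q := pred0)) ?/cnt ?count_pred0 // => r hr.
    by rewrite ltnNge legain.
  by rewrite big_ord0 addn0.
- move=> i s2; rewrite n1 => hi r2 f2 [x2 y2 h2 t2].
  have [fN fF fK] : [/\ rg s2 rNW = n, rg s2 rF = F & rg s2 rK = rg s rK].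
    by split; rewrite f2.
  have E : rg s2 rN + hp s2 (F + (n + n) + (n - i)) = cnt n (fun r => n - i.+1 < gain r).
    rewrite x2 h2 addnA hg; last by lia.
    rewrite /cnt -count_predUI [X in _ + X](@eq_count _ _ pred0) ?count_pred0 ?addn0.
      by apply: eq_in_count => r; rewrite mem_iota add0n /= => /legain; lia.
    by move=> r /=; case: eqP; lia.
  split; rewrite /= ?updE //=.
  + by rewrite fF fN r2.
  (* With truncated subtraction, [k - (k - N)] is [minn k N]. *)
  + rewrite fF fN r2 E fK y2 big_ord_recr /= addnA; congr (_ + _).
    by lia.
  by rewrite t2; lia.
move=> s2 [[x2 y2 h2 t2] _ ->]; rewrite n1 in y2 t2; split=> //=.
  (* The loop meets the thresholds from [n - 1] down to 0. *)
  rewrite y2 (reindex_inj rev_ord_inj) /=; congr (_ + _).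
  apply: eq_bigr => j _; congr minn; apply: eq_cnt => r hr.
  by have := ltn_ord j; lia.
by rewrite t2; lia.
Qed.

(** In a chosen class, voters with favourite [a] work for the challenger [c], those with favourite
    [b] for [p]. *)
Definition beats nv n k (favV favW rep : nat -> nat) p c a b : bool :=
  cnt nv (fun i => favV i == p) < cnt nv (fun i => favV i == c) +
    \sum_(g < n) minn k (cnt n (fun r =>
       g < class_count rep favW n a r - class_count rep favW n b r)).

(* Each challenger works in fresh memory, which is still zero. *)
Definition conclude : cmd :=
  CSeq (CSet rANS (ESub (EC 1) (ESub (EC 1) (EAdd (ER rANS) (ESub (ER rY) (ER rX))))))
  (CSeq (incr rF (EAdd (EAdd (ER rNW) (EAdd (ER rNW) (ER rNW))) (EC 1)))
        (incr rC (EC 1))).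

Lemma exec_conclude s : exec conclude s = State (upd (upd (upd (rg s)
   rANS (1 - (1 - (rg s rANS + (rg s rY - rg s rX)))))
   rF (rg s rF + (rg s rNW + (rg s rNW + rg s rNW) + 1))) rC (rg s rC + 1))
   (hp s) (tm s).+3.
Proof. by []. Qed.

Definition candidate (rA rB : nat) : cmd :=
  CSeq base_scores (CSeq (tally_classes rA rB) (CSeq histogram (CSeq add_best conclude))).

(** Zero memory from [F] on is required, and zero memory from the new [rF] on is returned: this is
    what lets the loop over challengers repeat the body without clearing anything. *)
Lemma candidateP rA rB s nv n F favV favW rep :
  rA \in [:: rC; rPP] -> rB \in [:: rC; rPP] ->
  rg s rNV = nv -> rg s rNW = n -> rg s rF = F ->
  rg s rR + n <= F -> rg s rW + n <= F ->
  (forall i, i < nv -> hp s (rg s rV + i) = favV i) ->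
  (forall i, i < n -> hp s (rg s rR + i) = rep i) ->
  (forall i, i < n -> hp s (rg s rW + i) = favW i) ->
  (forall i, i < n -> rep i < n) ->
  (forall h, F <= h -> hp s h = 0) ->
  let s' := exec (candidate rA rB) s in
  let win := beats nv n (rg s rK) favV favW rep (rg s rPP) (rg s rC) (rg s rA) (rg s rB) in
  [/\ rg s' rANS = (0 < rg s rANS) || win,
      rg s' rF = F + (n + n + n + 1) /\ rg s' rC = rg s rC + 1,
      forall h, h < F -> hp s' h = hp s h,
      forall h, F + (n + n + n + 1) <= h -> hp s' h = 0
    & tm s' = tm s + (3 * nv + 12 * n + 14)].
Proof.
move=> hA hB snv sn sF hR hW hV hrep hfW lrep hz.
rewrite /candidate 4!exec_seq.
have [x1 y1 h1 t1] := base_scoresP s.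
set s1 := exec base_scores s in x1 y1 h1 t1 *.
have f1 x : x \notin mods base_scores -> rg s1 x = rg s x by exact: exec_frame.
have mA : rA \notin [:: rI; rU] by move: hA; rewrite !inE => /orP[] /eqP->.
have mB : rB \notin [:: rI; rU] by move: hB; rewrite !inE => /orP[] /eqP->.
have fA : rg s1 rA = rg s rA by move: hA; rewrite !inE => /orP[] /eqP->; exact: f1.
have fB : rg s1 rB = rg s rB by move: hB; rewrite !inE => /orP[] /eqP->; exact: f1.
have [a2 b2 h2 z2 t2] : let s2 := exec (tally_classes rA rB) s1 in
  [/\ forall r, r < n -> hp s2 (F + r) = class_count rep favW n (rg s1 rA) r,
      forall r, r < n -> hp s2 (F + n + r) = class_count rep favW n (rg s1 rB) r,
      forall h, h < F -> hp s2 h = hp s1 h,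
      forall h, F + n + n <= h -> hp s2 h = 0
    & tm s2 = tm s1 + 5 * n + 2].
  by apply: tally_classesP; rewrite ?f1 //= => i hi; rewrite h1 ?hrep ?hfW ?hz.
set s2 := exec (tally_classes rA rB) s1 in a2 b2 h2 z2 t2 *.
have f2 x : x \notin [:: rI; rU] -> rg s2 x = rg s1 x.
  move=> hx; apply: exec_frame; move: hx; rewrite /= !inE !negb_or.
  by case/andP=> -> ->.
have [a3 h3 z3 t3] : let s3 := exec histogram s2 in
  [/\ forall g, g <= n -> hp s3 (F + n + n + g) = cnt n (fun r =>
           class_count rep favW n (rg s1 rA) r - class_count rep favW n (rg s1 rB) r == g),
      forall h, h < F + n + n -> hp s3 h = hp s2 h,
      forall h, F + n + n + n < h -> hp s3 h = 0
    & tm s3 = tm s2 + 4 * n + 2].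
  by apply: histogramP; rewrite ?(f2 rNW) ?(f1 rNW) ?(f2 rF) ?(f1 rF) //= => r _; exact: cnt_le.
set s3 := exec histogram s2 in a3 h3 z3 t3 *.
have f3 x : x \notin mods histogram -> rg s3 x = rg s2 x by exact: exec_frame.
have [y4 h4 t4] := @add_bestP s3 n F (fun r =>
  class_count rep favW n (rg s1 rA) r - class_count rep favW n (rg s1 rB) r)
  (etrans (f3 rNW isT) (etrans (f2 rNW isT) (etrans (f1 rNW isT) sn)))
  (etrans (f3 rF isT) (etrans (f2 rF isT) (etrans (f1 rF isT) sF)))
  (fun r _ => leq_trans (leq_subr _ _) (cnt_le _ _)) a3.
set s4 := exec add_best s3 in y4 h4 t4 *.
have f4 x : x \notin mods add_best -> rg s4 x = rg s3 x by exact: exec_frame.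
have X4 : rg s4 rX = cnt nv (fun i => favV i == rg s rPP).
  by rewrite f4 // f3 // f2 // x1 snv; apply: eq_cnt => i hi; rewrite hV.
have Y4 : rg s4 rY = cnt nv (fun i => favV i == rg s rC) +
    \sum_(g < n) minn (rg s rK) (cnt n (fun r =>
       g < class_count rep favW n (rg s rA) r - class_count rep favW n (rg s rB) r)).
  rewrite y4 !f3 // !f2 // y1 f1 // snv fA fB; congr (_ + _).
  by apply: eq_cnt => i hi; rewrite hV.
have [N4 F4] : rg s4 rNW = n /\ rg s4 rF = F by rewrite !f4 // !f3 // !f2 // !f1.
have [C4 A4] : rg s4 rC = rg s rC /\ rg s4 rANS = rg s rANS.
  by rewrite !f4 // !f3 // !f2 // !f1.
clearbody s4.
rewrite exec_conclude N4 F4 C4 A4; split; rewrite ?[hp _]/= ?[tm _]/=.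
(* [1 - (1 - z)] tests whether [z] is positive, so [rANS] accumulates a disjunction without
   branching. *)
- rewrite [LHS]/= !updE /= /beats -X4 -Y4.
  by case: (ltnP (rg s4 rX) (rg s4 rY)); case: (ltnP 0 (rg s rANS)); lia.
- by split; rewrite [LHS]/= !updE //=; lia.
- by move=> h hh; rewrite h4 h3 ?h2 ?h1 //; lia.
- by move=> h hh; rewrite h4 z3 //; lia.
by rewrite t4 t3 t2 t1 snv; lia.
Qed.

Definition core (rA rB : nat) : cmd :=
  CSeq (CSet rANS (EC 0)) (CSeq (CSet rC (EC 0)) (CLoop rJ (candidate rA rB))).

(* The value held by register [r], one of [rC] and [rPP], when the challenger is [c]. *)
Definition value_of (r c p : nat) := if r == rC then c else p.

Lemma coreP rA rB s nv n F favV favW rep :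
  rA \in [:: rC; rPP] -> rB \in [:: rC; rPP] ->
  rg s rNV = nv -> rg s rNW = n -> rg s rF = F ->
  rg s rR + n <= F -> rg s rW + n <= F -> rg s rV + nv <= F ->
  (forall i, i < nv -> hp s (rg s rV + i) = favV i) ->
  (forall i, i < n -> hp s (rg s rR + i) = rep i) ->
  (forall i, i < n -> hp s (rg s rW + i) = favW i) ->
  (forall i, i < n -> rep i < n) ->
  (forall h, F <= h -> hp s h = 0) ->
  let s' := exec (core rA rB) s in
  let p := rg s rPP in
  rg s' rANS = has (fun c => beats nv n (rg s rK) favV favW rep p c (value_of rA c p) (value_of rB c p))
     (iota 0 (rg s rJ)) /\
  tm s' = tm s + rg s rJ * (3 * nv + 12 * n + 15) + 3.
Proof.
move=> hA hB snv sn sF hR hW hVF hV hrep hfW lrep hz.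
rewrite /core 2!exec_seq; set s1 := exec (CSet rC _) _.
have rJm : rJ \notin mods (candidate rA rB) by [].
set W := (fun c => beats _ _ _ _ _ _ _ c _ _).
case: (@exec_loop rJ (candidate rA rB)
  (fun i s2 => [/\ rg s2 rANS = has W (iota 0 i), rg s2 rC = i,
     [/\ F <= rg s2 rF, forall h, h < F -> hp s2 h = hp s h &
         forall h, rg s2 rF <= h -> hp s2 h = 0]
     & tm s2 = tm s + i * (3 * nv + 12 * n + 15) + 2]) s1) => //.
- by split=> //=; [split=> // | lia]; rewrite /= !updE /= sF.
- move=> i s2 hi r2 f2 [a2 c2 [lF h2 z2] t2].
  have f x : x \notin rJ :: mods (candidate rA rB) -> x \notin [:: rANS; rC] -> rg s2 x = rg s x.
    move=> hx; rewrite f2 // !inE negb_or => /andP[e1 e2].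
    by rewrite /s1 /= updE (negbTE e2) updE (negbTE e1).
  have [fnv fn fV fR fW] : [/\ rg s2 rNV = nv, rg s2 rNW = n, rg s2 rV = rg s rV,
     rg s2 rR = rg s rR & rg s2 rW = rg s rW] by split; rewrite f.
  have [fP fK] : rg s2 rPP = rg s rPP /\ rg s2 rK = rg s rK by rewrite !f.
  have pA : rg s2 rA = value_of rA i (rg s rPP).
    by move: hA; rewrite !inE => /orP[] /eqP->.
  have pB : rg s2 rB = value_of rB i (rg s rPP).
    by move: hB; rewrite !inE => /orP[] /eqP->.
  case: (@candidateP rA rB s2 nv n (rg s2 rF) favV favW rep) => //.
  + by rewrite fR; lia.
  + by rewrite fW; lia.
  + by move=> j hj; rewrite fV h2 ?hV //; lia.
  + by move=> j hj; rewrite fR h2 ?hrep //; lia.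
  + by move=> j hj; rewrite fW h2 ?hfW //; lia.
  move=> a3 [F3 C3] h3 z3 t3.
  set s3 := exec _ s2 in a3 F3 C3 h3 z3 t3 *; clearbody s3.
  have f3 x : x != rJ -> rg (dec rJ s3) x = rg s3 x by move=> /negbTE h; rewrite /= updE h.
  rewrite !f3 //; split.
  + rewrite a3 pA pB fP fK c2 a2 -(addn1 i) iotaD has_cat /= orbF add0n.
    by congr (nat_of_bool (_ || _)); case: (has _ _).
  + by rewrite C3 c2 addn1.
  + rewrite F3; split=> [|h hh|h hh]; first by lia.
      by rewrite [LHS]h3 ?h2 //; lia.
    by rewrite [LHS]z3.
  rewrite [LHS]/= t3 t2; lia.
move=> s2 [[a2 _ _ t2] _ ->]; split; first exact: a2.
by rewrite [LHS]/= t2; have -> : rg s1 rJ = rg s rJ by []; lia.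
Qed.

(** * Reading the bundles *)

Definition min_step : cmd :=
  CSeq (CSet rMN (ESub (ER rMN) (ESub (ER rMN) (ELd (ER rP))))) (incr rP (EC 1)).

(* Representatives are written over the encoding of the bundles; the write pointer never
   overtakes the read pointer because no bundle is empty. *)
Definition read_bundle : cmd :=
  CSeq (CSet rS (ELd (ER rP))) (CSeq (incr rP (EC 1)) (CSeq (CSet rMN (ELd (ER rP)))
  (CSeq (CLoop rS min_step)
  (CSeq (CStore (ER rQ) (ER rMN)) (incr rQ (EC 1)))))).

Lemma min_loopP P s (b : seq nat) :
  rg s rP = P -> rg s rS = size b -> (forall j, j < size b -> hp s (P + j) = nth 0 b j) ->
  let s' := exec (CLoop rS min_step) s in
  [/\ rg s' rMN = foldl minn (rg s rMN) b, rg s' rP = P + size b, hp s' =1 hp s &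
      tm s' = tm s + 3 * size b + 1].
Proof.
move=> sP sS hb.
case: (@exec_loop rS min_step
  (fun i s2 => [/\ rg s2 rMN = foldl minn (rg s rMN) (take i b), rg s2 rP = P + i,
      hp s2 =1 hp s & tm s2 = tm s + 3 * i]) s) => //.
- by split=> //; rewrite ?take0 //; lia.
- move=> i s2; rewrite sS => hi r2 f2 [m2 p2 h2 t2].
  split; rewrite /= ?updE //=; try lia.
  by rewrite (take_nth 0) // foldl_rcons -m2 p2 h2 hb //; lia.
move=> s2 [[m2 p2 h2 t2] _ ->]; rewrite sS take_size in m2 p2 t2.
by split=> //=; lia.
Qed.

Lemma enc_bundles_cat k1 k2 : enc_bundles (k1 ++ k2) = enc_bundles k1 ++ enc_bundles k2.
Proof. by rewrite /enc_bundles map_cat flatten_cat. Qed.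

Lemma enc_bundles_cons b k : enc_bundles (b :: k) = (size b :: b) ++ enc_bundles k.
Proof. by []. Qed.

Lemma nth_enc_bundles kappa rest i j : i < size kappa -> j <= size (nth [::] kappa i) ->
  nth 0 (enc_bundles kappa ++ rest) (size (enc_bundles (take i kappa)) + j) =
  nth 0 (size (nth [::] kappa i) :: nth [::] kappa i) j.
Proof.
move=> hi hj; rewrite -{1}(cat_take_drop i kappa) (drop_nth [::] hi) enc_bundles_cat.
rewrite -catA nth_cat ltnNge leq_addr addKn enc_bundles_cons -catA nth_cat.
by rewrite /= ltnS hj.
Qed.

Definition read_bundles : cmd := cfor rNW read_bundle.

Lemma read_bundlesP s n P kappa rest : bundling_ok n kappa ->
  rg s rNW = n -> rg s rP = P -> rg s rQ = P ->
  (forall j, hp s (P + j) = nth 0 (enc_bundles kappa ++ rest) j) ->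
  let s' := exec read_bundles s in
  [/\ rg s' rP = P + size (enc_bundles kappa),
      n <= size (enc_bundles kappa),
      forall i, i < n -> hp s' (P + i) = bundle_rep kappa i,
      forall h, (h < P) || (P + size (enc_bundles kappa) <= h) -> hp s' h = hp s h &
      tm s' <= tm s + 10 * size (enc_bundles kappa) + 2].
Proof.
move=> ok sn sP sQ henc.
have [sk _] := ok.
pose len i := size (enc_bundles (take i kappa)).
case: (@exec_for rNW read_bundle
  (fun i s2 => [/\ rg s2 rP = P + len i /\ rg s2 rQ = P + i, i <= len i,
      forall j, j < i -> hp s2 (P + j) = bundle_rep kappa j,
      forall h, (h < P) || (P + len i <= h) -> hp s2 h = hp s h &
      tm s2 <= tm s + 10 * len i + 1]) s) => //.
- by split=> //=; rewrite /len take0 //= ?sP ?sQ ?addn0 //; lia.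
- move=> i s2; rewrite sn => hi _ _ [[p2 q2] l2 b2 h2 t2].
  have hik : i < size kappa by rewrite sk.
  set b := nth [::] kappa i.
  have lenS : len i.+1 = len i + (size b).+1.
    by rewrite /len (take_nth [::]) // -cats1 enc_bundles_cat size_cat /= cats0.
  have rd j : j <= size b -> hp s2 (P + len i + j) = nth 0 (size b :: b) j.
    by move=> hj; rewrite h2 -?addnA ?henc ?nth_enc_bundles //; apply/orP; right; lia.
  have b_gt0 : 0 < size b.
    by have := bundle_rep_mem ok hi; rewrite -/b; case: (b).
  rewrite /read_bundle 3!exec_seq.
  set s3 := exec (CSet rMN _) _.
  have S3 : rg s3 rS = size b by rewrite /s3 /= ?updE /= ?updE /= p2 -[P + len i]addn0 rd.
  have P3 : rg s3 rP = P + len i + 1 by rewrite /s3 /= ?updE /= ?updE /= p2.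
  have Q3 : rg s3 rQ = P + i by rewrite /s3 /= ?updE /= q2.
  have M3 : rg s3 rMN = head 0 b.
    by rewrite /s3 /= ?updE /= ?updE /= p2 rd //= nth0.
  have [M4 P4 h4 t4] : let s4 := exec (CLoop rS min_step) s3 in
    [/\ rg s4 rMN = foldl minn (rg s3 rMN) b, rg s4 rP = P + len i + 1 + size b, hp s4 =1 hp s3 &
      tm s4 = tm s3 + 3 * size b + 1].
    by apply: min_loopP => // j hj; rewrite -addnA [hp s3 _](rd (1 + j)).
  rewrite 2!exec_seq; set s4 := exec _ s3 in M4 P4 h4 t4 *.
  have Q4 : rg s4 rQ = P + i by rewrite exec_frame.
  have M4' : rg s4 rMN = bundle_rep kappa i by rewrite M4 M3.
  have hp5 h : hp (dec rI (exec (incr rQ (EC 1)) (exec (CStore (ER rQ) (ER rMN)) s4))) h =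
      upd (hp s2) (P + i) (bundle_rep kappa i) h.
    by rewrite -Q4 -M4' /= !updE; case: eqP => // _; exact: h4.
  split.
  + split; rewrite [LHS]/= !updE [LHS]/= ?Q4 ?P4 ?lenS; lia.
  + by rewrite lenS; lia.
  + move=> j hj; rewrite hp5 updE eqn_add2l; case: eqP => [->//|ne].
    by apply: b2; lia.
  + by move=> h hh; rewrite hp5 updE ifF ?h2 //; lia.
  have t3 : tm s3 = (tm s2).+3 by [].
  (* A bundle of size [b] costs [3 b + 7], which is at most 10 for each of its [b + 1] encoded
     symbols. *)
  rewrite -[tm (dec _ _)]/((tm s4).+3) t4 t3 lenS; lia.
move=> s2 [[[p2 _] l2 b2 h2 t2] _ e].
have lenn : len n = size (enc_bundles kappa) by rewrite /len -sk take_size.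
rewrite sn lenn in p2 l2 b2 h2 t2.
by rewrite /read_bundles e; split=> //=; lia.
Qed.

Definition decide (rA rB : nat) : cmd :=
  CSeq (CSet rP (ER rR)) (CSeq (CSet rQ (ER rR)) (CSeq read_bundles
  (CSeq (CSet rPP (ELd (ER rP))) (CSeq (CSet rK (ELd (EAdd (ER rP) (EC 1))))
  (CSeq (CSet rF (EAdd (ER rP) (EC 2))) (core rA rB)))))).

(** Both encodings end with the bundles, [p] and [k]; [pre] and the offset [wo] absorb what differs.
    For deletion the fixed and the bundled voters are the same array, so [wo] is 2. *)
Lemma decideP rA rB s B wo nv n favV favW pre kappa p k :
  rA \in [:: rC; rPP] -> rB \in [:: rC; rPP] ->
  bundling_ok n kappa ->
  let input := pre ++ enc_bundles kappa ++ [:: p; k] in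
  (forall j, hp s (B + j) = nth 0 input j) ->
  rg s rR = B + size pre -> rg s rV = B + 2 -> rg s rW = B + wo ->
  rg s rNV = nv -> rg s rNW = n -> 2 + nv <= size pre -> wo + n <= size pre ->
  (forall i, i < nv -> nth 0 input (2 + i) = favV i) ->
  (forall i, i < n -> nth 0 input (wo + i) = favW i) ->
  let s' := exec (decide rA rB) s in
  rg s' rANS = has (fun c => beats nv n k favV favW (bundle_rep kappa) p c
                               (value_of rA c p) (value_of rB c p)) (iota 0 (rg s rJ)) /\
  tm s' <= tm s + 10 * size input + rg s rJ * (15 * size input + 15) + 10.
Proof.
move=> hA hB ok input hin sR sV sW snv sn lenv lewo hV hW.
rewrite /decide 3!exec_seq; set s1 := exec (CSet rQ _) _.
have szi : size input = size pre + size (enc_bundles kappa) + 2.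
  by rewrite /input !size_cat /= addnA.
have [P1 Q1 R1] : [/\ rg s1 rP = B + size pre, rg s1 rQ = B + size pre & rg s1 rR = B + size pre].
  by rewrite -sR.
have f1 x : x \notin [:: rP; rQ] -> rg s1 x = rg s x.
  by rewrite !inE negb_or => /andP[e1 e2]; rewrite /= !updE (negbTE e1) (negbTE e2).
have [h1 t1] : hp s1 = hp s /\ tm s1 = (tm s).+2 by [].
clearbody s1.
have n1 : rg s1 rNW = n by rewrite f1.
have hin1 j : hp s1 (B + size pre + j) = nth 0 (enc_bundles kappa ++ [:: p; k]) j.
  by rewrite h1 -addnA hin /input nth_cat ltnNge leq_addr addKn.
have [P2 l2 b2 h2 t2] := read_bundlesP ok n1 P1 Q1 hin1.
have f2 x : x \notin mods read_bundles -> rg (exec read_bundles s1) x = rg s1 x.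
  exact: exec_frame.
set s2 := exec read_bundles s1 in P2 b2 h2 t2 f2 *; clearbody s2.
have hp2 j : size pre + size (enc_bundles kappa) <= j -> hp s2 (B + j) = nth 0 input j.
  by move=> hj; rewrite h2 ?h1 ?hin //; apply/orP; right; lia.
have hp2' j : j < size pre -> hp s2 (B + j) = nth 0 input j.
  by move=> hj; rewrite h2 ?h1 ?hin //; apply/orP; left; lia.
rewrite 3!exec_seq; set s3 := exec (CSet rF _) _.
have P3 : rg s3 rPP = p.
  have -> : rg s3 rPP = hp s2 (rg s2 rP) by [].
  rewrite P2 -addnA hp2 // /input catA nth_cat size_cat ltnn subnn //.
have K3 : rg s3 rK = k.
  have -> : rg s3 rK = hp s2 (rg s2 rP + 1) by [].
  rewrite P2 -!addnA hp2; last by lia.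
  by rewrite /input catA nth_cat size_cat addnA ltnNge leq_addr addKn.
have F3 : rg s3 rF = B + size input.
  have -> : rg s3 rF = rg s2 rP + 2 by [].
  by rewrite P2 szi; lia.
have f3 x : x \notin [:: rPP; rK; rF] -> rg s3 x = rg s2 x.
  rewrite !inE !negb_or => /and3P[e1 e2 e3].
  by rewrite /= !updE (negbTE e1) (negbTE e2) (negbTE e3).
have [h3 t3] : hp s3 = hp s2 /\ tm s3 = (tm s2).+3 by [].
clearbody s3.
have [R3 V3 W3] : [/\ rg s3 rR = B + size pre, rg s3 rV = B + 2 & rg s3 rW = B + wo].
  by rewrite !f3 // !f2 // R1 !f1.
have [nv3 n3 J3] : [/\ rg s3 rNV = nv, rg s3 rNW = n & rg s3 rJ = rg s rJ].
  by rewrite !f3 // !f2 // !f1.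
case: (@coreP rA rB s3 nv n (B + size input) favV favW (bundle_rep kappa)) => //.
- by rewrite R3; lia.
- by rewrite W3; lia.
- by rewrite V3; lia.
- by move=> i hi; rewrite V3 h3 -addnA hp2' ?hV //; lia.
- by move=> i hi; rewrite R3 h3 b2.
- by move=> i hi; rewrite W3 h3 -addnA hp2' ?hW //; lia.
- by move=> i hi; exact: bundle_rep_lt.
- move=> h hh; rewrite h3; have -> : h = B + (h - B) by lia.
  by rewrite hp2 ?nth_default //; lia.
rewrite P3 K3 J3 => -> ->; split=> //.
(* Each voter's favourite is an input symbol, so [nv] and [n] are both at most the input size. *)
rewrite t3; have : 3 * nv + 12 * n + 15 <= 15 * size input + 15 by lia.
by move/(leq_mul (leqnn (rg s rJ))); lia.
Qed.

(** * The two decision problems *)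

Definition header (eW eNW : expr) : cmd :=
  CSeq (CSet rJ (ELd (ER rP))) (CSeq (CSet rNV (ELd (EAdd (ER rP) (EC 1))))
  (CSeq (CSet rV (EAdd (ER rP) (EC 2))) (CSeq (CSet rW eW) (CSeq (CSet rNW eNW)
  (CSet rR (EAdd (ER rW) (ER rNW))))))).

(* Adding a class gains its voters for the challenger, deleting it gains its voters for the
   distinguished candidate: the two problems swap the roles of [rA] and [rB]. *)
Definition add_cmd : cmd :=
  CSeq (header (EAdd (EAdd (ER rV) (ER rNV)) (EC 1)) (ELd (EAdd (ER rV) (ER rNV))))
       (decide rC rPP).

Definition del_cmd : cmd := CSeq (header (ER rV) (ER rNV)) (decide rPP rC).

Lemma beatsP n kappa nv k favV favW p c a b :
  bundling_ok n kappa -> bdisjoint n kappa ->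
  beats nv n k favV favW (bundle_rep kappa) p c a b <->
  exists X, [/\ uniq X, all (fun x => x < n) X, size X <= k &
    cnt nv (fun i => favV i == p) + cnt n (fun w => in_bundle kappa X w && (favW w == b)) <
    cnt nv (fun i => favV i == c) + cnt n (fun w => in_bundle kappa X w && (favW w == a))].
Proof.
move=> ok dis; set x := cnt nv _; set y := cnt nv _.
have h := @select_classes n kappa ok dis k favW (fun u v => x + u < y + v) b a.
rewrite h /beats -/x -/y; apply: iff_sym; apply: best_choice => r _; exact: cnt_le.
Qed.

(** Since [m] and [N] are positive, [m], [N] and [m * N] are all at most [m * N]; the coefficients
    add up to 104 with a remainder of 19, and 200 generously covers both. *)
Lemma time_bound m N t : 0 < m -> 0 < N ->
  t <= 64 * N + 3 + 6 + 10 * N + m * (15 * N + 15) + 10 ->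
  size prologue + 60 * t <= (size prologue + 60 * 200) * (m * N) + (size prologue + 60 * 200).
Proof.
move=> m0 N0 ht.
have : t <= 200 * (m * N) + 200.
  have : N <= m * N by rewrite leq_pmull.
  have : m <= m * N by rewrite leq_pmulr.
  by rewrite mulnDr mulnCA in ht; lia.
move: (size prologue) (m * N) => s x h.
have : 60 * t <= 60 * (200 * x + 200) by rewrite leq_mul2l h.
have : 0 <= s * x by [].
rewrite mulnDl; lia.
Qed.

Lemma has_iotaP (P : pred nat) m : has P (iota 0 m) <-> exists c, c < m /\ P c.
Proof.
split=> [/hasP[c]|[c [hc Pc]]]; first by rewrite mem_iota => h Pc; exists c.
by apply/hasP; exists c; rewrite ?mem_iota.
Qed.

Lemma CDesAddP I : add_wf I -> bdisjoint (size (afavW I)) (akappa I) ->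
  CDesAdd I <-> has (fun c => beats (size (afavV I)) (size (afavW I)) (ak I)
    (nth 0 (afavV I)) (nth 0 (afavW I)) (bundle_rep (akappa I)) (ap I) c c (ap I)) (iota 0 (am I)).
Proof.
move=> [_ [_ [_ ok]]] dis; rewrite has_iotaP; split.
  move=> [X [uX [aX [sX [c [hc h]]]]]]; exists c; split=> //.
  by apply/(beatsP _ _ _ _ _ _ _ _ ok dis); exists X.
move=> [c [hc /(beatsP _ _ _ _ _ _ _ _ ok dis)[X [uX aX sX h]]]].
by exists X; do 3!split=> //; exists c.
Qed.

Lemma score_negb fav sel c :
  score fav (fun w => ~~ sel w) c + cnt (size fav) (fun w => sel w && (nth 0 fav w == c)) =
  cnt (size fav) (fun w => nth 0 fav w == c).
Proof.
rewrite /score /cnt -count_predUI [X in _ + X](@eq_count _ _ pred0) ?count_pred0 ?addn0.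
  by apply: eq_count => w /=; case: (sel w); rewrite /= ?orbF.
by move=> w /=; case: (sel w); rewrite /= ?andbF.
Qed.

Lemma CDesDelP I : del_wf I -> bdisjoint (size (dfavV I)) (dkappa I) ->
  CDesDel I <-> has (fun c => beats (size (dfavV I)) (size (dfavV I)) (dk I)
    (nth 0 (dfavV I)) (nth 0 (dfavV I)) (bundle_rep (dkappa I)) (dp I) c (dp I) c) (iota 0 (dm I)).
Proof.
move=> [_ [_ ok]] dis; rewrite has_iotaP.
(* The voters deleted from each side are added to the other side instead, which gives the shape of
   [beatsP] with [p] and [c] exchanged as favourites. *)
have E X c : (del_score I X (dp I) < del_score I X c) =
  (cnt (size (dfavV I)) (fun w => nth 0 (dfavV I) w == dp I) +
     cnt (size (dfavV I)) (fun w => in_bundle (dkappa I) X w && (nth 0 (dfavV I) w == c)) <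
   cnt (size (dfavV I)) (fun w => nth 0 (dfavV I) w == c) +
     cnt (size (dfavV I)) (fun w => in_bundle (dkappa I) X w && (nth 0 (dfavV I) w == dp I))).
  have := score_negb (dfavV I) (in_bundle (dkappa I) X) (dp I).
  have := score_negb (dfavV I) (in_bundle (dkappa I) X) c.
  by rewrite /del_score; lia.
split.
  move=> [X [uX [aX [sX [c [hc h]]]]]]; exists c; split=> //.
  by apply/(beatsP _ _ _ _ _ _ _ _ ok dis); exists X; rewrite -E.
move=> [c [hc /(beatsP _ _ _ _ _ _ _ _ ok dis)[X [uX aX sX h]]]].
by exists X; do 3!split=> //; exists c; rewrite E.
Qed.

Lemma bool_answer (a : nat) (b : bool) (Q : Prop) : a = b -> (Q <-> b) ->
  a <= 1 /\ (a = 1 <-> Q).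
Proof. by move=> -> ->; case: b. Qed.

Lemma add_cmdP I s : add_wf I ->
  (forall j, hp s (rg s rP + j) = nth 0 (enc_add I) j) ->
  let s' := exec add_cmd s in
  rg s' rANS = has (fun c => beats (size (afavV I)) (size (afavW I)) (ak I)
    (nth 0 (afavV I)) (nth 0 (afavW I)) (bundle_rep (akappa I)) (ap I) c c (ap I)) (iota 0 (am I)) /\
  tm s' <= tm s + 6 + 10 * size (enc_add I) + am I * (15 * size (enc_add I) + 15) + 10.
Proof.
move=> [_ [_ [_ ok]]] hin; rewrite /add_cmd exec_seq.
pose pre := [:: am I; size (afavV I)] ++ afavV I ++ [:: size (afavW I)] ++ afavW I.
have eI : enc_add I = pre ++ enc_bundles (akappa I) ++ [:: ap I; ak I].
  by rewrite /enc_add /pre /= -catA.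
have nv0 : hp s (rg s rP + 1) = size (afavV I) by rewrite hin.
have m0 : hp s (rg s rP) = am I by rewrite -[rg s rP]addn0 hin.
have nthV i : i < size (afavV I) -> nth 0 (enc_add I) (2 + i) = nth 0 (afavV I) i.
  by move=> hi; rewrite /enc_add /= nth_cat hi.
have nthW i : i < size (afavW I) ->
    nth 0 (enc_add I) ((2 + size (afavV I) + 1) + i) = nth 0 (afavW I) i.
  move=> hi; have -> : enc_add I = (([:: am I; size (afavV I)] ++ afavV I) ++
      [:: size (afavW I)]) ++ afavW I ++ enc_bundles (akappa I) ++ [:: ap I; ak I].
    by rewrite -!catA.
  have <- : size (([:: am I; size (afavV I)] ++ afavV I) ++ [:: size (afavW I)]) =
      2 + size (afavV I) + 1 by rewrite !size_cat.
  by rewrite nth_cat ltnNge leq_addr addKn [nth 0 (afavW I ++ _) _]nth_cat hi.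
have nw0 : hp s (rg s rP + 2 + size (afavV I)) = size (afavW I).
  by rewrite -addnA hin /enc_add /= nth_cat ltnn subnn.
set s1 := exec (header _ _) s.
have [J1 V1 nv1] : [/\ rg s1 rJ = am I, rg s1 rV = rg s rP + 2 & rg s1 rNV = size (afavV I)].
  by rewrite -m0 -nv0.
have W1 : rg s1 rW = rg s rP + (2 + size (afavV I) + 1) by rewrite -nv0 !addnA.
have n1 : rg s1 rNW = size (afavW I) by rewrite -nw0 -nv0.
have R1 : rg s1 rR = rg s1 rW + rg s1 rNW by [].
have [h1 t1] : hp s1 = hp s /\ tm s1 = tm s + 6 by rewrite addnC.
clearbody s1; rewrite -t1 -J1 [in X in X + _ * _]eI eI.
apply: (decideP (B := rg s rP) _ _ ok _ _ V1 W1) => //.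
- by rewrite -eI h1.
- by rewrite R1 W1 n1 /pre /= ?size_cat /= ?size_cat; lia.
- by rewrite /pre /= ?size_cat /= ?size_cat; lia.
- by rewrite /pre /= ?size_cat /= ?size_cat; lia.
- by rewrite -eI.
by rewrite -eI.
Qed.

Lemma del_cmdP I s : del_wf I ->
  (forall j, hp s (rg s rP + j) = nth 0 (enc_del I) j) ->
  let s' := exec del_cmd s in
  rg s' rANS = has (fun c => beats (size (dfavV I)) (size (dfavV I)) (dk I)
    (nth 0 (dfavV I)) (nth 0 (dfavV I)) (bundle_rep (dkappa I)) (dp I) c (dp I) c) (iota 0 (dm I)) /\
  tm s' <= tm s + 6 + 10 * size (enc_del I) + dm I * (15 * size (enc_del I) + 15) + 10.
Proof.
move=> [_ [_ ok]] hin; rewrite /del_cmd exec_seq.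
pose pre := [:: dm I; size (dfavV I)] ++ dfavV I.
have eI : enc_del I = pre ++ enc_bundles (dkappa I) ++ [:: dp I; dk I] by [].
have nv0 : hp s (rg s rP + 1) = size (dfavV I) by rewrite hin.
have m0 : hp s (rg s rP) = dm I by rewrite -[rg s rP]addn0 hin.
have nthV i : i < size (dfavV I) -> nth 0 (enc_del I) (2 + i) = nth 0 (dfavV I) i.
  by move=> hi; rewrite /enc_del /= nth_cat hi.
set s1 := exec (header _ _) s.
have [J1 V1 nv1] : [/\ rg s1 rJ = dm I, rg s1 rV = rg s rP + 2 & rg s1 rNV = size (dfavV I)].
  by rewrite -m0 -nv0.
have W1 : rg s1 rW = rg s rP + 2 by [].
have n1 : rg s1 rNW = size (dfavV I) by rewrite -nv0.
have R1 : rg s1 rR = rg s1 rW + rg s1 rNW by [].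
have [h1 t1] : hp s1 = hp s /\ tm s1 = tm s + 6 by rewrite addnC.
clearbody s1; rewrite -t1 -J1 eI.
apply: (decideP (B := rg s rP) _ _ ok _ _ V1 W1) => //.
- by rewrite -eI h1.
by rewrite R1 W1 n1 /pre /=; lia.
Qed.

Lemma wf_add_cmd : wf_cmd add_cmd.
Proof. by vm_compute. Qed.

Lemma wf_del_cmd : wf_cmd del_cmd.
Proof. by vm_compute. Qed.

Theorem theorem5 :
  (exists (P : program) (c : nat),
     forall I : AddInst,
       add_wf I -> bsymmetric (size (afavW I)) (akappa I) ->
       bdisjoint (size (afavW I)) (akappa I) ->
       decides_within P (c * (am I * size (enc_add I)) + c) (enc_add I) (CDesAdd I))
  /\
  (exists (P : program) (c : nat),
     forall I : DelInst,
       del_wf I -> bsymmetric (size (dfavV I)) (dkappa I) ->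
       bdisjoint (size (dfavV I)) (dkappa I) ->
       decides_within P (c * (dm I * size (enc_del I)) + c) (enc_del I) (CDesDel I)).
Proof.
split.
  exists (compile add_cmd), (size prologue + 60 * 200) => I wf _ dis.
  apply: compile_decides => [||s ts hin]; [exact: wf_add_cmd | by [] |].
  have [ans time] := add_cmdP wf hin.
  have [a1 a2] := bool_answer ans (CDesAddP wf dis); split=> //.
  apply: time_bound; [by case: wf; lia | by [] | lia].
exists (compile del_cmd), (size prologue + 60 * 200) => I wf _ dis.
apply: compile_decides => [||s ts hin]; [exact: wf_del_cmd | by [] |].
have [ans time] := del_cmdP wf hin.
have [a1 a2] := bool_answer ans (CDesDelP wf dis); split=> //.
apply: time_bound; [by case: wf; lia | by [] | lia].
Qed.
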